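(* Each Euclidean plane $(\Pi,\mathcal{I})$ is isomorphic (as an Erlangen plane) to the complex plane.
   Context: A betweenness relation on a set $\Pi$ is a ternary relation ''$C$ is between $A$ and $B$'' such that, writing $s[A,B]$ for the set of all points between $A$ and $B$: (a) each point is between itself and any point of $\Pi$; (b) if $A$ is between $B$ and $C$, then $A$ is between $C$ and $B$; (c) if $C\in s[A,B]$, then $s[A,B]=s[A,C]\cup s[C,B]$ and $s[A,C]\cap s[C,B]=s[C,C]=\{C\}$. A closed line segment is a set of the form $s[A,B]$; its interior is $s(A,B)=s[A,B]\setminus\{A,B\}$. A subset $S$ is convex if $s[A,B]\subset S$ for all $A,B\in S$. A closed line segment is connected if, whenever it is expressed as a union of two disjoint non-empty convex subsets, precisely one of them is a closed line segment. An isomorphism of sets with betweenness is a bijection with $f(s[A,B])=s[f(A),f(B)]$ for all $A,B$. A line is a set $l$ with betweenness, consisting of at least two points, such that for every $A\in l$ the complement $l\setminus\{A\}$ is the union of two disjoint non-empty convex sets $c_1,c_2$ with $A\in s[B,C]$ whenever $B\in c_1$, $C\in c_2$. A line in $\Pi$ is a convex subset that is a line with the inherited betweenness. A ray emanating from $A$ is a convex set $r$ such that: $A\in r$ but $A$ is not between any two other points of $r$; every three points of $r$ are contained in a closed line segment which is a subset of $r$; $r$ is not equal to any closed line segment. It is maximal if it is not a proper subset of another ray emanating from $A$. A space with maximal rays is a set with betweenness such that (1) if $s[A,B]$ and $s[A,C]$ have a common interior point, then one of them is contained in the other; (2) if $A\neq B$ and $s[A,B]$ is connected, then there is a connected $s[C,D]$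 with $s[A,B]\subset s(C,D)$. When all segments are connected and $A\neq B$, $l(A,B)$ is the largest line in $\Pi$ containing $s[A,B]$ (a maximal line). A plane is a space $\Pi$ with maximal rays such that: $\Pi$ contains at least two points; for each pair of different points $A,B$ the segment $s[A,B]$ is connected and $\Pi\setminus l(A,B)$ is the union of two disjoint non-empty convex sets $h_1,h_2$ (half-planes with boundary $l(A,B)$) such that $s[C,D]$ intersects $l(A,B)$ at exactly one point whenever $C\in h_1$, $D\in h_2$. An Erlangen plane is a pair $(\Pi,\mathcal{I})$ of a plane $\Pi$ and a subgroup $\mathcal{I}$ of the group of isomorphisms of $\Pi$ such that for every two pairs $(h_1,r_1)$, $(h_2,r_2)$ consisting of a half-plane and a maximal ray in its boundary there is exactly one element of $\mathcal{I}$ sending $h_1$ onto $h_2$ and $r_1$ onto $r_2$. Two lines are parallel if they are equal or disjoint. A Euclidean plane is an Erlangen plane such that for every line $l(A,B)$ and every point $C$ there is a unique maximal line containing $C$ and parallel to $l(A,B)$. The complex plane is the Erlangen plane $\mathbb{C}$ with the betweenness induced by its structure of a real vector space ($A$ is between $B$ and $C$ iff $A=tB+(1-t)C$ for some $0\le t\le 1$) and with the group of all maps of the form $f(z)=(a+bi)z+w$ or $f(z)=(a+bi)\bar z+w$, where $a,b\in\mathbb{R}$, $a^2+b^2=1$, $w\in\mathbb{C}$. An isomorphism of Erlangen planes from $(\Pi_1,\mathcal{I}_1)$ to $(\Pi_2,\mathcal{I}_2)$ is an isomorphism $f:\Pi_1\to\Pi_2$ of sets with betweenness such that a bijection $g:\Pi_2\to\Pi_2$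 belongs to $\mathcal{I}_2$ if and only if $f^{-1}\circ g\circ f$ belongs to $\mathcal{I}_1$. *)

(* Defs.v *)
From mathcomp Require Import all_boot all_order all_algebra.
From mathcomp Require Import all_classical all_reals.
From mathcomp Require Import complex.

Set Implicit Arguments.
Unset Strict Implicit.
Unset Printing Implicit Defensive.

Import Order.TTheory GRing.Theory Num.Theory.
Local Open Scope classical_set_scope.
Local Open Scope ring_scope.
Local Open Scope complex_scope.

(** Sets with betweenness. [bt A B C] reads "A is between B and C". *)

Definition segment (T : Type) (bt : T -> T -> T -> Prop) (A B : T) : set T :=
  [set C | bt C A B].

Definition segment_interior (T : Type) (bt : T -> T -> T -> Prop) (A B : T) :
    set T :=
  segment bt A B `\` [set A; B].

Definition betweenness (T : Type) (bt : T -> T -> T -> Prop) : Prop :=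
  [/\ forall A B, bt A A B,
      forall A B C, bt A B C -> bt A C B
    & forall A B C, segment bt A B C ->
        [/\ segment bt A B = segment bt A C `|` segment bt C B,
            segment bt A C `&` segment bt C B = segment bt C C
          & segment bt C C = [set C]]].

Definition closed_segment (T : Type) (bt : T -> T -> T -> Prop) (S : set T) :
    Prop :=
  exists A B, S = segment bt A B.

Definition convex (T : Type) (bt : T -> T -> T -> Prop) (S : set T) : Prop :=
  forall A B, S A -> S B -> segment bt A B `<=` S.

Definition convex_split (T : Type) (bt : T -> T -> T -> Prop)
    (S c1 c2 : set T) : Prop :=
  [/\ S = c1 `|` c2, c1 `&` c2 = set0,
      c1 !=set0 /\ c2 !=set0 & convex bt c1 /\ convex bt c2].

Definition segment_connected (T : Type) (bt : T -> T -> T -> Prop)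
    (S : set T) : Prop :=
  forall c1 c2, convex_split bt S c1 c2 ->
    (closed_segment bt c1 /\ ~ closed_segment bt c2) \/
    (~ closed_segment bt c1 /\ closed_segment bt c2).

Definition isomorphism (T1 T2 : Type) (bt1 : T1 -> T1 -> T1 -> Prop)
    (bt2 : T2 -> T2 -> T2 -> Prop) (f : T1 -> T2) : Prop :=
  bijective f /\
  forall A B, f @` segment bt1 A B = segment bt2 (f A) (f B).

Definition line (T : Type) (bt : T -> T -> T -> Prop) : Prop :=
  [/\ betweenness bt,
      exists A B : T, A <> B
    & forall A : T, exists c1 c2 : set T,
        convex_split bt (~` [set A]) c1 c2 /\
        forall B C, c1 B -> c2 C -> segment bt B C A].

Definition inherited (T : Type) (bt : T -> T -> T -> Prop) (l : set T)
    (A B C : set_type l) : Prop :=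
  bt (val A) (val B) (val C).

Definition line_in (T : Type) (bt : T -> T -> T -> Prop) (l : set T) : Prop :=
  convex bt l /\ line (@inherited T bt l).

(** [largest_line bt A B l] says that [l] is l(A,B). *)
Definition largest_line (T : Type) (bt : T -> T -> T -> Prop) (A B : T)
    (l : set T) : Prop :=
  [/\ line_in bt l, segment bt A B `<=` l
    & forall l', line_in bt l' -> segment bt A B `<=` l' -> l' `<=` l].

Definition maximal_line (T : Type) (bt : T -> T -> T -> Prop) (l : set T) :
    Prop :=
  exists A B, A <> B /\ largest_line bt A B l.

Definition ray (T : Type) (bt : T -> T -> T -> Prop) (A : T) (r : set T) :
    Prop :=
  [/\ convex bt r,
      r A /\ (forall B C, r B -> r C -> B <> A -> C <> A -> ~ bt A B C),
      forall B C D, r B -> r C -> r D -> exists X Y,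
        [/\ segment bt X Y `<=` r, segment bt X Y B, segment bt X Y C
          & segment bt X Y D]
    & ~ closed_segment bt r].

Definition maximal_ray (T : Type) (bt : T -> T -> T -> Prop) (r : set T) :
    Prop :=
  exists A, ray bt A r /\ forall r', ray bt A r' -> ~ r `<` r'.

Definition space_with_maximal_rays (T : Type) (bt : T -> T -> T -> Prop) :
    Prop :=
  [/\ betweenness bt,
      forall A B C,
        segment_interior bt A B `&` segment_interior bt A C !=set0 ->
        segment bt A B `<=` segment bt A C \/
        segment bt A C `<=` segment bt A B
    & forall A B, A <> B -> segment_connected bt (segment bt A B) ->
        exists C D, segment_connected bt (segment bt C D) /\
          segment bt A B `<=` segment_interior bt C D].

(** Planes. *)

Definition separates (T : Type) (bt : T -> T -> T -> Prop)
    (l h1 h2 : set T) : Prop :=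
  convex_split bt (~` l) h1 h2 /\
  forall C D, h1 C -> h2 D -> exists! X, (segment bt C D `&` l) X.

Definition plane (T : Type) (bt : T -> T -> T -> Prop) : Prop :=
  [/\ space_with_maximal_rays bt,
      exists A B : T, A <> B
    & forall A B, A <> B ->
        segment_connected bt (segment bt A B) /\
        exists l, largest_line bt A B l /\ exists h1 h2, separates bt l h1 h2].

Definition half_plane (T : Type) (bt : T -> T -> T -> Prop) (l h : set T) :
    Prop :=
  maximal_line bt l /\ exists h', separates bt l h h'.

(** A half-plane together with a maximal ray in its boundary. *)
Definition flag (T : Type) (bt : T -> T -> T -> Prop) (h r : set T) : Prop :=
  exists l, [/\ half_plane bt l h, maximal_ray bt r & r `<=` l].

Definition isomorphism_subgroup (T : Type) (bt : T -> T -> T -> Prop)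
    (I : set (T -> T)) : Prop :=
  [/\ forall f, I f -> isomorphism bt bt f,
      I id,
      forall f g, I f -> I g -> I (f \o g)
    & forall f, I f -> exists g, [/\ I g, cancel f g & cancel g f]].

Definition erlangen_plane (T : Type) (bt : T -> T -> T -> Prop)
    (I : set (T -> T)) : Prop :=
  [/\ plane bt, isomorphism_subgroup bt I
    & forall h1 r1 h2 r2, flag bt h1 r1 -> flag bt h2 r2 ->
        exists! f, [/\ I f, f @` h1 = h2 & f @` r1 = r2]].

Definition parallel (T : Type) (l m : set T) : Prop :=
  l = m \/ l `&` m = set0.

Definition euclidean_plane (T : Type) (bt : T -> T -> T -> Prop)
    (I : set (T -> T)) : Prop :=
  erlangen_plane bt I /\
  forall A B l, A <> B -> largest_line bt A B l ->
    forall C, exists! m, [/\ maximal_line bt m, m C & parallel m l].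

Definition erlangen_isomorphic (T1 T2 : Type)
    (bt1 : T1 -> T1 -> T1 -> Prop) (I1 : set (T1 -> T1))
    (bt2 : T2 -> T2 -> T2 -> Prop) (I2 : set (T2 -> T2)) : Prop :=
  exists (f : T1 -> T2) (finv : T2 -> T1),
    [/\ isomorphism bt1 bt2 f, cancel f finv, cancel finv f
      & forall g : T2 -> T2, bijective g -> (I2 g <-> I1 (finv \o g \o f))].

(** The complex plane. *)

Definition complex_between (R : realType) (A B C : R[i]) : Prop :=
  exists t : R, 0 <= t <= 1 /\ A = t%:C * B + (1 - t)%:C * C.

Definition complex_group (R : realType) : set (R[i] -> R[i]) :=
  [set f | exists (a b : R) (w : R[i]), a ^+ 2 + b ^+ 2 = 1 /\
    ((forall z : R[i], f z = (a +i* b) * z + w) \/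
     (forall z : R[i], f z = (a +i* b) * conjc z + w))].

(* Main.v *)
Require Import Defs.
From HB Require Import structures.
From mathcomp Require Import all_boot all_order all_algebra.
From mathcomp Require Import all_classical all_reals.
From mathcomp Require Import complex.
From mathcomp Require Import ring lra.

(** The motion preserving a line and swapping both its sides and the two rays
from A is a half-turn about A; it does not depend on the line, so it maps every
line to a parallel one. Completeness of lines yields midpoints, and products of
two half-turns are translations; by the uniqueness of parallels these form an
abelian group acting simply transitively. Every line through the origin is then
a complete ordered group with halving, hence a copy of the real line, and since
parallel projections are monotone these copies fit together into real
coordinates in which betweenness is the standard one. In these coordinates a
motion fixing the origin is linear. An orientation-reversing motion has an
eigenvector with positive eigenvalue, so by sharp transitivity on flags it is an
involution of trace 0 and determinant -1; in a basis made of a vector and its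
image under a quarter-turn this forces the motions fixing the origin to be
exactly the orthogonal ones. *)

Set Implicit Arguments.
Unset Strict Implicit.
Unset Printing Implicit Defensive.

Import Order.TTheory GRing.Theory Num.Theory.
Local Open Scope classical_set_scope.
Local Open Scope ring_scope.

(** * Complete ordered groups *)

(** No length or angle is available before the end, so equality of motions always comes from one
    source: a motion that preserves a flag is the identity. The flag axiom controls a motion only on
    one chosen line; that a half-turn moves every other point straight through [A] as well has to be
    forced by the order of the rays at [A]. Likewise, a motion carrying the ray from [A] through [B]
    to the ray from [B] through [A] is not known to send [B] back to [A]; its fixed point is found
    by completeness, because it reverses the order. Real scalars do not come from a geometric
    multiplication: they are suprema of dyadic multiples in the translation group, and every
    linearity claim, for projections as for motions, reduces to the fact that an additive real
    function of constant sign on the positive reals is linear. *)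

Section OrderedLine.

Context (R : realType) (V : zmodType) (P : V -> Prop) (E : V).
Context (PD : forall x y, P x -> P y -> P (x + y))
  (P_anti : forall x, P x -> P (- x) -> x = 0)
  (P_total : forall x y, P x -> P y -> P (x - y) \/ P (y - x))
  (P_half : forall x, P x -> exists2 y, P y & y + y = x)
  (P_lub : forall (S : set V) y, S !=set0 ->
    (forall x, S x -> P x /\ P (y - x)) ->
    exists z, [/\ P z, forall x, S x -> P (z - x)
      & forall t, P t -> (forall x, S x -> P (t - x)) -> P (t - z)])
  (PE : P E) (E0 : E <> 0).

Let ple x y := P (y - x).

(* The order is total only on the subgroup of the signed elements. *)
Let signed x := P x \/ P (- x).

Lemma pos0 : P 0.
Proof. by have := P_total PE PE; rewrite subrr; case. Qed.

Lemma ple_refl x : ple x x.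
Proof. by rewrite /ple subrr; exact: pos0. Qed.

Lemma ple_trans x y z : ple x y -> ple y z -> ple x z.
Proof. by move=> h h'; have := PD h' h; rewrite subrKA. Qed.

Lemma ple_anti x y : ple x y -> ple y x -> x = y.
Proof. by move=> h h'; apply/subr0_eq/P_anti; rewrite ?opprB. Qed.

Lemma ple_add x y x' y' : ple x y -> ple x' y' -> ple (x + x') (y + y').
Proof. by move=> h h'; have := PD h h'; rewrite /ple opprD addrACA. Qed.

Lemma ple_add2r z x y : ple (x + z) (y + z) = ple x y.
Proof. by rewrite /ple opprD addrACA subrr addr0. Qed.

Lemma signedN x : signed x -> signed (- x).
Proof. by case=> h; [right; rewrite opprK|left]. Qed.

Lemma signed_sub x y : signed x -> signed y -> signed (x - y).
Proof.
have s a b : P a -> P b -> signed (a - b).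
  by move=> ha hb; case: (P_total ha hb); [left|right; rewrite opprB].
case=> hx [] hy.
- exact: s.
- by left; apply: PD.
- by right; rewrite opprB; apply: PD.
- by have := signedN (s _ _ hx hy); rewrite opprD !opprK.
Qed.

Lemma signedD x y : signed x -> signed y -> signed (x + y).
Proof. by move=> hx /signedN hy; rewrite -[y]opprK; exact: signed_sub. Qed.

Lemma ple_total x y : signed x -> signed y -> ple x y \/ ple y x.
Proof.
move=> hx hy; case: (signed_sub hx hy); first by right.
by rewrite opprB; left.
Qed.

(** [P_lub] only treats positive elements. Translating by a member [s0] of [S] and keeping what
    becomes positive loses nothing, since the discarded elements lie below [s0]. *)
Lemma signed_lub (S : set V) y : S !=set0 ->
  (forall x, S x -> signed x /\ ple x y) ->
  exists z, [/\ signed z, forall x, S x -> ple x z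
    & forall t, (forall x, S x -> ple x t) -> ple z t].
Proof.
move=> [s0 Ss0] hS; pose S' := [set x | P x /\ S (x + s0)].
have [||z [Pz ub lub]] := P_lub (S := S') (y := y - s0).
- by exists 0; split; [exact: pos0|rewrite add0r].
- move=> x [Px Sx]; split=> //.
  by have [_] := hS _ Sx; rewrite /ple opprD addrA addrAC.
- exists (z + s0); split.
  + by apply: signedD; [left|case: (hS _ Ss0)].
  + move=> x Sx; case: (ple_total (hS _ Ss0).1 (hS _ Sx).1) => h.
      by rewrite -[x](subrK s0) ple_add2r; apply: ub; split; rewrite ?subrK.
    by apply: ple_trans h _; rewrite /ple addrK.
  + move=> t ht; rewrite -[t](subrK s0) ple_add2r; apply: lub.
      exact: ht.
    move=> x [Px Sx]; have := ht _ Sx; rewrite /ple.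
    by rewrite opprD addrA addrAC.
Qed.

(** Archimedean property: a least upper bound [z] of the multiples of [x] could be lowered to
    [z - x], because the successor of each multiple is again at most [z]. *)
Lemma multiples_unbounded x y : P x -> x <> 0 -> P y -> exists n, ~ ple (x *+ n) y.
Proof.
move=> Px x0 Py; apply: contrapT => /forallNP h.
have [||z [_ ub lub]] := @signed_lub [set x *+ n | n in setT] y.
- by exists 0; exists 0%N.
- move=> _ [n _ <-]; split; last exact: contrapT (h n).
  by left; elim: n => [|n IH]; [exact: pos0|rewrite mulrS; exact: PD].
- apply/x0/P_anti => //; have : ple z (z - x).
    apply: lub => _ [n _ <-]; rewrite -(ple_add2r x) subrK -mulrSr.
    by apply: ub; exists n.+1.
  by rewrite /ple addrAC subrr add0r.
Qed.

(** For every [n], the multiple of [z] by [n] is at most that by [2 ^ n], hence at most [2 ^ n]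
    times [u n], which is [u 0]; a nonzero [z] would violate the Archimedean property. *)
Lemma halvings_small (u : nat -> V) z : (forall k, u k.+1 + u k.+1 = u k) ->
  P (u 0%N) -> P z -> (forall k, ple z (u k)) -> z = 0.
Proof.
move=> hu P0 Pz hz; apply: contrapT => z0.
have [n hn] := multiples_unbounded Pz z0 P0; apply: hn.
have h k : u 0%N = u k *+ 2 ^ k.
  by elim: k => [|k IH]; rewrite ?expn0 // IH -hu -mulr2n -mulrnA expnS.
rewrite (h n); apply: (ple_trans (y := z *+ 2 ^ n)).
  have := ltnW (ltn_expl n (ltnSn 1)); move=> /subnK <-.
  rewrite mulrnDr -{1}[z *+ n]add0r ple_add2r /ple subr0.
  by elim: (_ - _)%N => [|m IH]; [exact: pos0|rewrite mulrS; exact: PD].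
elim: (2 ^ n)%N => [|m IH]; first exact: ple_refl.
by rewrite !mulrS; exact: ple_add.
Qed.

Lemma halvings_ex : exists u : nat -> V,
  [/\ u 0%N = E, forall k, u k.+1 + u k.+1 = u k & forall k, P (u k)].
Proof.
pose next (x : {x | P x}) : {x | P x} :=
  let: exist2 y Py _ := cid2 (P_half (projT2 x)) in exist _ y Py.
pose u := nat_rect (fun _ => {x | P x}) (exist _ E PE) (fun _ => next).
exists (fun k => projT1 (u k)); split=> // k; last exact: projT2.
by rewrite /= /next; case: cid2.
Qed.

Lemma ordered_line_real : exists phi : R -> V,
  [/\ forall s t, phi (s + t) = phi s + phi t, phi 1 = E,
      forall t, 0 < t -> P (phi t) /\ phi t <> 0
    & forall x, P x -> exists2 t, 0 <= t & phi t = x].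
Proof.
have [e [e0 e2 Pe]] := halvings_ex.
(* phi t is the supremum of the dyadic multiples m / 2 ^ k of E with
   m / 2 ^ k < t, and e k stands for E / 2 ^ k. *)
have eM k j : e k = e (k + j)%N *~ (2 ^ j)%N%:Z.
  elim: j => [|j IH]; first by rewrite addn0.
  by rewrite IH addnS -e2 -mulr2n -pmulrn -mulrnA expnS.
have Pmul k (m : int) : 0 <= m -> P (e k *~ m).
  case: m => // m _; elim: m => [|m IH]; first exact: pos0.
  by rewrite -pmulrn mulrS; apply: PD.
have smul k (m : int) : signed (e k *~ m).
  case: (lerP 0 m) => h; first by left; exact: Pmul.
  by right; rewrite -mulrNz; apply: Pmul; rewrite oppr_ge0 ltW.
pose below t := [set x | exists k (m : int), x = e k *~ m /\ m%:~R < t * 2 ^+ k :> R].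
have common k j (m : int) t : m%:~R < t * 2 ^+ k :> R ->
    e k *~ m = e (k + j)%N *~ (m * (2 ^ j)%N%:Z) /\
    (m * (2 ^ j)%N%:Z)%:~R < t * 2 ^+ (k + j) :> R.
  move=> h; split; first by rewrite mulrC mulrzA -eM.
  by rewrite intrM -pmulrn natrX exprD mulrA ltr_pM2r // exprn_gt0.
have mono k (m m' : int) : m <= m' -> ple (e k *~ m) (e k *~ m').
  by move=> h; rewrite /ple -mulrzBr; apply: Pmul; rewrite subr_ge0.
have pow2 (d : R) : 0 < d -> exists j, 1 < d * 2 ^+ j.
  move=> d0; exists (Num.bound d^-1).
  by rewrite -ltr_pdivrMl // mulr1; exact: upper_nthrootP.
have below_lub t : exists z, [/\ signed z, forall x, below t x -> ple x z
    & forall y, (forall x, below t x -> ple x y) -> ple z y].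
  apply: (signed_lub (y := E *~ Num.ceil t)).
    (* The inequality in [below] is strict, so [Num.floor t] itself would fail for an integral [t];
       hence the [- 1]. *)
    exists (e 0%N *~ (Num.floor t - 1)), 0%N, (Num.floor t - 1); split=> //.
    by rewrite expr0 mulr1 intrB ltrBlDr (le_lt_trans (floor_le t)) // ltrDl.
  move=> _ [k [m [-> h]]]; split=> //.
  rewrite -e0 (eM 0%N k) add0n -mulrzA mulrC; apply: mono.
  rewrite -(ler_int R) intrM -pmulrn natrX (le_trans (ltW h)) //.
  by rewrite ler_pM2r ?exprn_gt0 // ceil_ge.
pose phi t := sval (cid (below_lub t)).
have phi_signed t : signed (phi t) by have [] := svalP (cid (below_lub t)).
have phi_ub t x : below t x -> ple x (phi t).
  by have [_ h _] := svalP (cid (below_lub t)); exact: h.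
have phi_lub t y : (forall x, below t x -> ple x y) -> ple (phi t) y.
  by have [_ _ h] := svalP (cid (below_lub t)); exact: h.
(* Refine the dyadic scale until the gap below [s + t] exceeds one unit. Then an integer [m1] fits
   strictly between [m' - t * 2 ^+ (k + j)] and [s * 2 ^+ (k + j)], and [m'] splits into [m1] and
   [m' - m1]. *)
have belowD s t x : below (s + t) x ->
    exists x1 x2, [/\ below s x1, below t x2 & x = x1 + x2].
  move=> [k [m [-> h]]].
  have [|j hj] := pow2 ((s + t) * 2 ^+ k - m%:~R); first by rewrite subr_gt0.
  have [-> hm] := common k j m _ h; set m' := m * _ in hm *.
  pose a := m'%:~R - t * 2 ^+ (k + j) : R.
  have ha : a + 1 < s * 2 ^+ (k + j).
    rewrite /a -addrA addrC -ltrBrDr addrC -ltrBrDr; apply: lt_le_trans hj _.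
    by rewrite /m' intrM -pmulrn natrX mulrBl -mulrA -exprD mulrDl opprK; lra.
  pose m1 := Num.floor a + 1.
  exists (e (k + j)%N *~ m1), (e (k + j)%N *~ (m' - m1)).
  split; last by rewrite -mulrzDr addrC subrK.
  - exists (k + j)%N, m1; split=> //; apply: le_lt_trans ha.
    by rewrite /m1 intrD lerD2r floor_le.
  - exists (k + j)%N, (m' - m1); split=> //.
    rewrite intrB ltrBlDr -ltrBlDl; exact: floorD1_gt.
have belowD' s t x y : below s x -> below t y -> below (s + t) (x + y).
  move=> [k [m [-> h]]] [k' [m' [-> h']]].
  have [-> g] := common k k' m _ h; have [-> g'] := common k' k m' _ h'.
  rewrite [in e (k' + k)%N]addnC -mulrzDr; rewrite [(k' + k)%N]addnC in g'.
  by exists (k + k')%N; eexists; split=> //; rewrite intrD mulrDl ltrD.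
have phiD s t : phi (s + t) = phi s + phi t.
  apply: ple_anti.
    apply: (phi_lub) => _ /belowD[x [y [hx hy ->]]].
    by apply: ple_add; exact: phi_ub.
  rewrite -[phi (s + t)](subrK (phi t)) ple_add2r; apply: (phi_lub) => x hx.
  rewrite /ple addrAC -/(ple _ _); apply: (phi_lub) => y hy.
  by rewrite /ple -addrA -opprD -/(ple _ _) ; apply: (phi_ub); exact: belowD'.
have phi1 : phi 1 = E.
  have below1 k (m : int) : m < (2 ^ k)%N%:Z -> below 1 (e k *~ m).
    by move=> h; exists k, m; split=> //; rewrite mul1r -natrX pmulrn ltr_int.
  (* The multiple of [e k] by [2 ^ k - 1] is already below [1], so [E - phi 1] is at most [e k] for
     every [k], hence zero. *)
  apply/esym/subr0_eq/(halvings_small e2); first by rewrite e0.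
  - apply: (phi_lub) => _ [k [m [-> h]]]; rewrite -e0 (eM 0%N k) add0n; apply: mono.
    by rewrite -(ler_int R) -pmulrn natrX ltW // -[X in _ < X]mul1r.
  - move=> k; have h : ple (e k *~ ((2 ^ k)%N%:Z - 1)) (phi 1).
      by apply: (phi_ub); apply: below1; rewrite ltrBlDr ltrDl.
    move: h; rewrite mulrzBr mulr1z -[e k *~ (2 ^ k)%N%:Z](eM 0%N k) e0.
    by rewrite /ple !opprB addrCA.
have phi0 : phi 0 = 0 by apply: (addrI (phi 0)); rewrite -phiD !addr0.
have phiN t : phi (- t) = - phi t.
  by apply: (addrI (phi t)); rewrite -phiD !subrr.
have phi_pos t : 0 < t -> P (phi t) /\ phi t <> 0.
  move=> t0; have [j hj] := pow2 _ t0.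
  have h : ple (e j) (phi t) by apply: (phi_ub); exists j, 1.
  have nj : e j <> 0.
    elim: (j) => [|i IH]; first by rewrite e0.
    by move=> z; apply: IH; rewrite -e2 z addr0.
  split; first by rewrite -[phi t](subrK (e j)); exact: PD.
  by move=> z; apply: nj; apply: P_anti => //; have := h; rewrite /ple z sub0r.
have phi_ge0 t : 0 <= t -> P (phi t).
  by rewrite le_eqVlt => /orP[/eqP <-|/phi_pos[]//]; rewrite phi0; exact: pos0.
have phi_mono s t : s <= t -> ple (phi s) (phi t).
  by move=> h; rewrite /ple -phiN -phiD; apply: phi_ge0; rewrite subr_ge0.
exists phi; split=> // x Px.
pose u k := phi (2 ^- k).
have u2 k : u k.+1 + u k.+1 = u k.
  rewrite /u -phiD; congr phi; rewrite exprS invfM; set z := _ ^- k.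
  by rewrite -mulrDl (_ : 2^-1 + 2^-1 = 1) ?mul1r //; field.
have Pu0 : P (u 0%N) by rewrite /u expr0 invr1 phi1.
have u_small z : P z -> z <> 0 -> exists k, ple (u k) z.
  move=> Pz nz; apply: contrapT => /forallNP h; apply: nz.
  apply: (halvings_small u2) => // k.
  have su : signed (u k) by exact: phi_signed.
  by case: (ple_total su (or_introl Pz)) => // /h.
(* The preimage of [x] is [sup S]. If [phi (sup S)] missed [x], the gap would be at least
   [phi (2 ^- k)] for some [k]: from below, [sup S + 2 ^- k] would still belong to [S]; from above,
   no member of [S] could come within [2 ^- k] of [sup S]. *)
pose S := [set t | 0 <= t /\ ple (phi t) x].
have supS : has_sup S.
  split; first by exists 0; split=> //; rewrite phi0 /ple subr0.
  have [n hn] := multiples_unbounded PE E0 Px; exists n%:R => t [t0 ht].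
  rewrite leNgt; apply/negP => nt; apply: hn; apply: ple_trans ht.
  have -> : E *+ n = phi n%:R.
    by elim: (n) => [|k IH]; rewrite ?phi0 // mulrSr IH -phi1 -phiD -natr1.
  exact/phi_mono/ltW.
have t0 : 0 <= sup S by apply: sup_upper_bound => //; split=> //; rewrite phi0 /ple subr0.
exists (sup S) => //; set t := sup S.
apply: contrapT => ntx.
have gt0 k : 0 < 2 ^- k :> R by rewrite invr_gt0 exprn_gt0.
case: (ple_total (phi_signed t) (or_introl Px)) => h.
- have [k hk] : exists k, ple (u k) (x - phi t).
    by apply: u_small => // /subr0_eq/esym.
  have : S (t + 2 ^- k).
    split; first by rewrite addr_ge0 // ltW.
    by rewrite phiD -[x](subrK (phi t)) addrC ple_add2r.
  by move/(sup_upper_bound supS); rewrite -/t gerDl leNgt gt0.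
- have [k hk] : exists k, ple (u k) (phi t - x).
    by apply: u_small => // /subr0_eq.
  have [t' [t'0 ht'] lt] := sup_adherent (gt0 k) supS.
  have d0 : 0 < t' - (t - 2 ^- k) by rewrite subr_gt0.
  have [Pd nd] := phi_pos _ d0; apply: nd; apply: P_anti => //.
  rewrite -phiN opprB phiD phiN -/(ple _ _); apply: ple_trans ht' _.
  rewrite phiD phiN -/(u k); move: hk; rewrite /ple.
  by rewrite addrAC.
Qed.

End OrderedLine.

(** * Pointwise consequences of the betweenness axioms *)

Section EuclideanPlane.

Context (T : Type) (bt : T -> T -> T -> Prop) (I : set (T -> T)).
Context (euclidean_bt : euclidean_plane bt I).

Implicit Types (A B C D E M N O P Q W X Y Z : T) (l m n : set T).

Lemma plane_bt : plane bt. Proof. by have [[]] := euclidean_bt. Qed.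

Lemma space_bt : space_with_maximal_rays bt.
Proof. by have [] := plane_bt. Qed.

Lemma betweenness_bt : betweenness bt.
Proof. by have [] := space_bt. Qed.

Lemma bt_l A B : bt A A B.
Proof. by have [h _ _] := betweenness_bt; exact: h. Qed.

Lemma bt_sym A B C : bt A B C -> bt A C B.
Proof. by have [_ h _] := betweenness_bt; exact: h. Qed.

Lemma bt_r A B : bt A B A.
Proof. exact/bt_sym/bt_l. Qed.

Lemma bt_union A B C D : bt C A B -> bt D A B <-> bt D A C \/ bt D C B.
Proof.
move=> h; have [_ _ /(_ _ _ _ h) [e _ _]] := betweenness_bt.
by have := congr1 (fun S : set T => S D) e; rewrite /segment /setU /= => ->.
Qed.

Lemma bt_meet A B C D : bt C A B -> bt D A C -> bt D C B -> D = C.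
Proof.
move=> h h1 h2; have [_ _ /(_ _ _ _ h) [_ e e']] := betweenness_bt.
have : (segment bt A C `&` segment bt C B) D by [].
by rewrite e e'.
Qed.

Lemma bt_id A B : bt A B B -> A = B.
Proof. by move=> h; apply: (bt_meet (bt_l B B)). Qed.

Lemma bt_sub A B C D : bt C A B -> bt D A C -> bt D A B.
Proof. by move=> h h'; apply/(bt_union D h); left. Qed.

Lemma bt_subr A B C D : bt C A B -> bt D C B -> bt D A B.
Proof. by move=> h h'; apply/(bt_union D h); right. Qed.

Lemma bt_anti A B C : bt B A C -> bt C A B -> B = C.
Proof. by move=> h h'; apply: (bt_meet h' h); exact: bt_r. Qed.

(** [D] cuts the segment in two; were [C] in the part next to [A], antisymmetry would give
    [C = D]. *)
Lemma bt_inner A B C D : bt C A B -> bt D A C -> bt C D B.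
Proof.
move=> h h'; have h2 := bt_sub h h'.
case: (proj1 (bt_union C h2) h) => [h3|//].
by rewrite (bt_anti h3 h'); exact: bt_l.
Qed.

Lemma bt_common A B C D : D <> A -> D <> B -> D <> C -> bt D A B -> bt D A C ->
  bt B A C \/ bt C A B.
Proof.
move=> nA nB nC hB hC; have [_ h _] := space_bt.
have [|s|s] := h A B C.
- by exists D; split; split => // -[].
- by left; apply: s; exact: bt_r.
- by right; apply: s; exact: bt_r.
Qed.

Lemma connected_bt A B : A <> B -> segment_connected bt (segment bt A B).
Proof. by move=> nAB; have [_ _ /(_ _ _ nAB) []] := plane_bt. Qed.

Lemma bt_extend A B : A <> B -> exists C, bt B A C /\ C <> B.
Proof.
move=> nAB; have [_ _ h] := space_bt.
have [C [D [_ s]]] := h _ _ nAB (connected_bt nAB).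
have [hA /not_orP[nAC nAD]] := s _ (bt_l A B).
have [hB /not_orP[nBC nBD]] := s _ (bt_r B A).
case: (proj1 (bt_union B hA) hB) => h'.
  by exists C; split; [exact: bt_sym | exact: nesym].
by exists D; split => //; exact: nesym.
Qed.

(** A segment consisting of its endpoints only would be the union of two singletons, both of them
    degenerate closed segments, while connectedness allows exactly one. *)
Lemma bt_dense A B : A <> B -> exists C, [/\ bt C A B, C <> A & C <> B].
Proof.
move=> nAB; apply: contrapT => h.
have bAB C : bt C A B -> C = A \/ C = B.
  move=> hC; apply: contrapT => /not_orP[nA nB].
  by apply: h; exists C.
have cl C : closed_segment bt [set C].
  exists C, C; apply/seteqP; split=> [x ->|x /bt_id //]; exact: bt_l.
have cv C : convex bt [set C] by move=> _ _ -> -> x /bt_id.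
have [] := connected_bt nAB (c1 := [set A]) (c2 := [set B]).
- split=> //.
  + apply/seteqP; split=> [x /bAB //|x [->|->]]; [exact: bt_l | exact: bt_r].
  + by apply/seteqP; split => // x [-> /nAB].
  + by split; eexists.
- by case=> _ /(_ (cl B)).
- by case=> /(_ (cl A)).
Qed.

(** * Lines *)

(** By convexity [B] and [C] lie in different halves of [l] minus [A], so one of them is in the half
    that does not contain [D]. *)
Lemma line_sides l A B C D : line_in bt l -> l A -> l B -> l C -> l D ->
  B <> A -> C <> A -> D <> A -> bt A B C -> bt A B D \/ bt A C D.
Proof.
move=> [_ [_ _ sl]] lA lB lC lD nB nC nD hA.
pose el X (lX : l X) : set_type l := exist _ X (mem_set lX).
have [c1 [c2 [[e e0 _ [cv1 cv2]] cr]]] := sl (el _ lA).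
have cov X (lX : l X) : X <> A -> c1 (el _ lX) \/ c2 (el _ lX).
  move=> nX; suff : (c1 `|` c2) (el _ lX) by [].
  by rewrite -e => /(congr1 val).
have nc : ~ c1 (el _ lA) /\ ~ c2 (el _ lA).
  apply/not_orP => h; have : (c1 `|` c2) (el _ lA) by [].
  by rewrite -e; apply.
case: (cov _ lB nB) (cov _ lC nC) (cov _ lD nD) => hB [] hC [] hD.
- by case: nc.1; apply: (cv1 _ _ hB hC).
- by left; exact: (cr _ _ hB hD).
- by right; apply: bt_sym; exact: (cr _ _ hD hC).
- by left; exact: (cr _ _ hB hD).
- by left; apply: bt_sym; exact: (cr _ _ hD hB).
- by right; exact: (cr _ _ hC hD).
- by left; apply: bt_sym; exact: (cr _ _ hD hB).
- by case: nc.2; apply: (cv2 _ _ hB hC).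
Qed.

Lemma line_opp l A B : line_in bt l -> l A -> l B -> B <> A ->
  exists C, [/\ l C, C <> A & bt A B C].
Proof.
move=> [_ [_ _ sl]] lA lB nB.
pose el X (lX : l X) : set_type l := exist _ X (mem_set lX).
have [c1 [c2 [[e e0 [[X c1X] [Y c2Y]] _] cr]]] := sl (el _ lA).
have nA z : c1 z \/ c2 z -> val z <> A.
  move=> cz zA; have : (c1 `|` c2) z by [].
  by rewrite -e; apply; apply: val_inj.
have : (c1 `|` c2) (el _ lB) by rewrite -e => /(congr1 val).
case=> hB.
- exists (val Y); split; [exact/set_mem/valP | by apply: nA; right |].
  exact: (cr _ _ hB c2Y).
- exists (val X); split; [exact/set_mem/valP | by apply: nA; left |].
  by apply: bt_sym; exact: (cr _ _ c1X hB).
Qed.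

(** If [B] and [C] are on the same side of [A], compare them from a point [D] on the other side: the
    segments from [D] to [B] and to [C] share the interior point [A], so one contains the other. *)
Lemma line_total l A B C : line_in bt l -> l A -> l B -> l C ->
  [\/ bt A B C, bt B A C | bt C A B].
Proof.
move=> hl lA lB lC.
have [->|nB] := pselect (B = A); first by constructor 1; exact: bt_l.
have [->|nC] := pselect (C = A); first by constructor 1; exact: bt_r.
have [D [lD nD hD]] := line_opp hl lA lB nB.
case: (line_sides hl lA lB lD lC nB nD nC hD) => [|h]; first by constructor 1.
have h' : bt A D B by exact: bt_sym.
case: (bt_common (nesym nD) (nesym nB) (nesym nC) h' h) => h2.
- by constructor 2; exact: bt_inner h2 h'.
- by constructor 3; exact: bt_inner h2 h.
Qed.

(** A pointwise candidate for l(A,B), confirmed in [lin_largest]; with it, membership and images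
    under isomorphisms reduce to betweenness. *)
Definition lin A B : set T := [set X | [\/ bt X A B, bt A B X | bt B A X]].

Lemma lin_largest A B : A <> B -> largest_line bt A B (lin A B).
Proof.
move=> nAB; have [_ _ /(_ _ _ nAB) [_ [l [hl _]]]] := plane_bt.
have [li sl mx] := hl; suff <- : l = lin A B by [].
have [lA lB] := (sl _ (bt_l A B), sl _ (bt_r B A)).
apply/seteqP; split=> X.
  move=> lX; case: (line_total li lX lA lB) => h; first by constructor 1.
  - by constructor 2; exact: bt_sym.
  - by constructor 3; exact: bt_sym.
(* The largest line through two points of [l] is [l] again, by maximality in both directions. *)
have eqm C D m : l C -> l D -> largest_line bt C D m -> l = m.
  move=> lC lD [mi sm mxm].
  have lm : l `<=` m by apply: mxm => //; exact: li.1 lC lD.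
  apply/seteqP; split=> //; apply: mx => //; exact: mi.1 (lm _ lA) (lm _ lB).
have lar C D : C <> D -> exists m, largest_line bt C D m.
  by move=> nCD; have [_ _ /(_ _ _ nCD) [_ [m [? _]]]] := plane_bt; exists m.
(* [l] is closed under prolongation: the largest line through [C] and [X] contains [D], so it lies
   inside the largest line through [C] and [D], which is [l]. *)
have ext C D : l C -> l D -> C <> D -> bt D C X -> l X.
  move=> lC lD nCD hD; have nCX : C <> X.
    by move=> e; apply: nCD; rewrite -e in hD; rewrite (bt_id hD).
  have [m [mi sm _]] := lar _ _ nCX.
  have mC := sm _ (bt_l C X); have mD := sm _ hD.
  have [k hk] := lar _ _ nCD; rewrite (eqm _ _ _ lC lD hk).
  case: hk => _ _ mxk; apply: (mxk m) => //.
  - exact: mi.1 mC mD.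
  - exact: sm _ (bt_r X C).
case=> h; first exact: sl.
- by apply: (ext B A) => //; exact: nesym.
- exact: (ext A B).
Qed.

Lemma lin_l A B : lin A B A. Proof. by constructor 1; exact: bt_l. Qed.

Lemma lin_r A B : lin A B B. Proof. by constructor 1; exact: bt_r. Qed.

Lemma lin_sym A B : lin A B = lin B A.
Proof.
have s C D : lin C D `<=` lin D C.
  by move=> X [/bt_sym h|h|h]; [constructor 1|constructor 3|constructor 2].
by apply/seteqP; split; exact: s.
Qed.

Lemma lin_in A B C D : A <> B -> C <> D -> lin A B C -> lin A B D ->
  lin A B = lin C D.
Proof.
move=> nAB nCD hC hD.
have [li sl mx] := lin_largest nAB; have [li' sl' mx'] := lin_largest nCD.
have s : lin A B `<=` lin C D by apply: mx' => //; exact: li.1.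
apply/seteqP; split => //; apply: mx => //; apply: li'.1.
- exact/s/lin_l.
- exact/s/lin_r.
Qed.

Lemma lin_total A B X Y Z : A <> B -> lin A B X -> lin A B Y -> lin A B Z ->
  [\/ bt X Y Z, bt Y X Z | bt Z X Y].
Proof. by move=> /lin_largest[li _ _]; exact: line_total. Qed.

(** For [B = C] both betweenness hypotheses hold trivially. Otherwise [A] and [C] lie on different
    sides of [B] (unless [A = B]), and [D] is on the side of [C]. *)
Lemma bt_outer A B C D : B <> C -> bt B A C -> bt C B D -> bt B A D.
Proof.
move=> nBC hA hD; have [<-|nAB] := pselect (A = B); first exact: bt_l.
have nDB : D <> B by move=> e; rewrite e in hD; exact: nBC (esym (bt_id hD)).
have [li _ _] := lin_largest nBC.
have lA : lin B C A by constructor 2; exact: bt_sym.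
have lD : lin B C D by constructor 3.
case: (line_sides li (lin_l B C) lA (lin_r B C) lD) => // [|h]; first exact: nesym.
by case: nBC; apply: (bt_anti (bt_sym h)); exact: bt_sym.
Qed.

Definition is_lin l := exists A B, A <> B /\ l = lin A B.

Lemma is_lin_lin A B : A <> B -> is_lin (lin A B).
Proof. by exists A, B. Qed.
#[local] Hint Resolve is_lin_lin : core.

Lemma is_linE l A B : is_lin l -> A <> B -> l A -> l B -> l = lin A B.
Proof. by move=> [C [D [nCD ->]]] nAB; exact: lin_in. Qed.

Lemma is_lin_eq l m A B : is_lin l -> is_lin m -> A <> B ->
  l A -> l B -> m A -> m B -> l = m.
Proof.
move=> hl hm n lA lB mA mB.
by transitivity (lin A B); [|apply/esym]; apply: is_linE.
Qed.

Lemma is_lin_convex l A B : is_lin l -> l A -> l B -> segment bt A B `<=` l.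
Proof. by move=> [C [D [/lin_largest[li _ _] ->]]]; exact: li.1. Qed.

Lemma is_linP l : is_lin l <-> maximal_line bt l.
Proof.
split=> [[A [B [n ->]]]|[A [B [n hl]]]]; exists A, B; split=> //.
  exact: lin_largest.
have [li sl mx] := hl; have [li' sl' mx'] := lin_largest n.
by apply/seteqP; split; [exact: mx'|exact: mx].
Qed.

(** * Half-lines *)

Definition halfline A B : set T := [set X | bt X A B \/ bt B A X].

Lemma halfline_l A B : halfline A B A. Proof. by left; exact: bt_l. Qed.

Lemma halfline_r A B : halfline A B B. Proof. by left; exact: bt_r. Qed.

Lemma halfline_sym A B X : halfline A B X -> halfline A X B.
Proof. by case; [right|left]. Qed.

Lemma halfline_lin A B : halfline A B `<=` lin A B.
Proof. by move=> X []; [constructor 1|constructor 3]. Qed.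

Lemma lin_halfline A B X : lin A B X -> halfline A B X \/ bt A B X.
Proof. by case=> ?; [left; left|right|left; right]. Qed.

Lemma halfline_total A B X Y : A <> B -> halfline A B X -> halfline A B Y ->
  bt X A Y \/ bt Y A X.
Proof.
move=> nAB [hX|hX] [hY|hY].
- case: (proj1 (bt_union Y hX) hY); first by right.
  by move=> h; left; apply: bt_sym; apply: (bt_inner (bt_sym hX)); exact: bt_sym.
- by left; exact: bt_sub hX.
- by right; exact: bt_sub hY.
- have [<-|nX] := pselect (B = X); first by left.
  have [<-|nY] := pselect (B = Y); first by right.
  by apply: bt_common hX hY => //; exact: nesym.
Qed.

Lemma halflineE A B X : A <> B -> X <> A -> halfline A B X ->
  halfline A X = halfline A B.
Proof.
have s C Y : A <> C -> halfline A C Y -> halfline A C `<=` halfline A Y.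
  move=> nAC hY Z hZ; have [?|?] := halfline_total nAC hY hZ; by [right|left].
move=> nAB nX hX; apply/seteqP; split; last exact: s.
by apply: s; [exact: nesym|exact: halfline_sym].
Qed.

Lemma halfline_opp A B C X : A <> B -> halfline A B X -> bt A B C -> bt A X C.
Proof.
move=> nAB [h|h] hA; first by apply: (bt_inner hA); exact: bt_sym.
by apply: bt_sym; apply: (bt_outer nAB _ h); exact: bt_sym.
Qed.

Lemma opp_opp A X Y Z : Y <> A -> bt A X Y -> bt A Y Z -> halfline A X Z.
Proof.
move=> nY hX hZ; have [->|nX] := pselect (X = A); first by right; exact: bt_l.
have [->|nZ] := pselect (Z = A); first exact: halfline_l.
have nAY := nesym nY.
have lX : lin A Y X by constructor 2; exact: bt_sym.
have lZ : lin A Y Z by constructor 2.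
case: (lin_total nAY (lin_l A Y) lX lZ) => h; [|by right; exact: h|by left; exact: h].
case: (bt_common (nesym nX) nAY (nesym nZ) hX h) => h2.
- case: nY; apply: (bt_anti (A := Z)); apply: bt_sym => //.
  exact: bt_inner h2 hX.
- by case: nZ; apply: (bt_anti (A := Y)) => //; apply/bt_sym/(bt_inner h2 h).
Qed.

Lemma halfline_end A B X Y : A <> B -> X <> A -> Y <> A ->
  halfline A B X -> halfline A B Y -> ~ bt A X Y.
Proof.
move=> nAB nX nY hX hY hA.
case: (halfline_total nAB hX hY) => h.
- by case: nX; apply: bt_anti (bt_sym h) (bt_sym hA).
- by case: nY; apply: bt_anti (bt_sym h) hA.
Qed.

(** * Sides of a line *)

(** The plane axiom yields the two half-planes unlabelled. As relations between points the sides
    never have to be named, and they are transported along isomorphisms pointwise. *)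
Definition side l X Y := [/\ ~ l X, ~ l Y & forall Z, bt Z X Y -> ~ l Z].

Definition opposite l X Y :=
  [/\ ~ l X, ~ l Y & exists2 Z, bt Z X Y & l Z].

Lemma is_lin_sep l : is_lin l -> exists h1 h2, separates bt l h1 h2.
Proof.
move=> [A [B [n ->]]]; have [_ _ /(_ _ _ n) [_ [m [hm hs]]]] := plane_bt.
suff -> : lin A B = m by [].
have [li sl mx] := hm; have [li' sl' mx'] := lin_largest n.
by apply/seteqP; split; [exact: mx|exact: mx'].
Qed.

Lemma sep_side l h1 h2 X Y : separates bt l h1 h2 ->
  side l X Y <-> h1 X /\ h1 Y \/ h2 X /\ h2 Y.
Proof.
move=> [[e e0 _ [cv1 cv2]] cr].
have cov Z : ~ l Z <-> h1 Z \/ h2 Z.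
  by have := congr1 (fun S : set T => S Z) e; rewrite /setC /setU /= => ->.
split=> [[/cov nX /cov nY h]|].
  case: nX nY => hX [] hY; [by left| | |by right].
  - by have [Z [[hZ lZ] _]] := cr _ _ hX hY; case: (h Z hZ).
  - by have [Z [[hZ lZ] _]] := cr _ _ hY hX; case: (h Z (bt_sym hZ)).
case=> -[hX hY]; split; rewrite ?cov; auto=> Z hZ; apply/cov.
- by left; exact: cv1 hZ.
- by right; exact: cv2 hZ.
Qed.

Lemma sep_opposite l h1 h2 X Y : separates bt l h1 h2 ->
  opposite l X Y <-> h1 X /\ h2 Y \/ h2 X /\ h1 Y.
Proof.
move=> s; have [[e e0 _ _] cr] := s.
have cov Z : ~ l Z <-> h1 Z \/ h2 Z.
  by have := congr1 (fun S : set T => S Z) e; rewrite /setC /setU /= => ->.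
split=> [[nX nY [Z hZ lZ]]|].
  have ns : ~ side l X Y by case=> _ _ /(_ Z hZ).
  by move/cov: nX => nX; move/cov: nY => nY; move/(sep_side X Y s): ns; tauto.
case=> -[hX hY]; split; rewrite ?cov; auto.
- by have [Z [[]]] := cr _ _ hX hY; exists Z.
- by have [Z [[hZ lZ] _]] := cr _ _ hY hX; exists Z => //; exact: bt_sym.
Qed.

Lemma sep_disj l h1 h2 X : separates bt l h1 h2 -> h1 X -> h2 X -> False.
Proof.
move=> [[_ e0 _ _] _] h h'; have : (h1 `&` h2) X by [].
by rewrite e0.
Qed.

Lemma side_refl l X : ~ l X -> side l X X.
Proof. by split=> // Z /bt_id ->. Qed.

Lemma side_sym l X Y : side l X Y -> side l Y X.
Proof. by case=> nX nY h; split=> // Z /bt_sym; exact: h. Qed.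

Lemma opposite_sym l X Y : opposite l X Y -> opposite l Y X.
Proof. by case=> nX nY [Z h lZ]; split=> //; exists Z => //; exact: bt_sym. Qed.

Lemma side_not_opposite l X Y : side l X Y -> ~ opposite l X Y.
Proof. by case=> _ _ h [_ _ [Z /h]]. Qed.

Lemma side_or_opposite l X Y : ~ l X -> ~ l Y -> side l X Y \/ opposite l X Y.
Proof.
move=> nX nY; have [h|h] := pselect (exists2 Z, bt Z X Y & l Z); first by right.
by left; split=> // Z hZ lZ; apply: h; exists Z.
Qed.

Lemma side_trans l X Y Z : is_lin l -> side l X Y -> side l Y Z -> side l X Z.
Proof.
move=> /is_lin_sep[h1 [h2 s]]; have d := sep_disj s.
by rewrite !(sep_side _ _ s); have := @d Y; tauto.
Qed.

Lemma side_opposite l X Y Z : is_lin l ->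
  side l X Y -> opposite l Y Z -> opposite l X Z.
Proof.
move=> /is_lin_sep[h1 [h2 s]]; have d := sep_disj s.
by rewrite !(sep_side _ _ s) !(sep_opposite _ _ s); have := @d Y; tauto.
Qed.

Lemma opposite_opposite l X Y Z : is_lin l ->
  opposite l X Y -> opposite l Y Z -> side l X Z.
Proof.
move=> /is_lin_sep[h1 [h2 s]]; have d := sep_disj s.
by rewrite !(sep_side _ _ s) !(sep_opposite _ _ s); have := @d Y; tauto.
Qed.

Lemma opposite_bt l A X Y : is_lin l -> l A -> ~ l X -> Y <> A -> bt A X Y ->
  opposite l X Y.
Proof.
move=> hl lA nX nY h; split=> //; last by exists A.
move=> lY; apply: nX; rewrite (is_linE hl nY lY lA); constructor 3.
exact: bt_sym.
Qed.

Lemma side_halfline l A X Y : is_lin l -> l A -> ~ l X -> Y <> A ->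
  halfline A X Y -> side l X Y.
Proof.
move=> hl lA nX nY h; have nAX : A <> X by move=> e; apply: nX; rewrite -e.
have nlY : ~ l Y.
  move=> lY; apply: nX; rewrite (is_linE hl nY lY lA) lin_sym.
  exact/halfline_lin/halfline_sym.
split=> // Z hZ lZ.
have [ZA|nZ] := pselect (Z = A).
  by rewrite ZA in hZ; case: (halfline_end nAX (nesym nAX) nY (halfline_r A X) h).
apply: nX; rewrite (is_linE hl nZ lZ lA).
have hZ' : lin A X Z.
  have [li _ _] := lin_largest nAX; apply: (li.1 _ _ _ _ _ hZ).
  - exact: lin_r.
  - exact: halfline_lin.
by rewrite lin_sym -(lin_in nAX (nesym nZ) (lin_l A X) hZ'); exact: lin_r.
Qed.

Lemma is_lin_off l : is_lin l -> exists X, ~ l X.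
Proof.
move=> /is_lin_sep[h1 [h2 [[e _ [[X hX] _] _] _]]]; exists X => lX.
have : (h1 `|` h2) X by left.
by rewrite -e; apply.
Qed.

Lemma opposite_ex l X : is_lin l -> ~ l X -> exists Y, opposite l X Y.
Proof.
move=> hl nX; have [A [B [_ e]]] := hl.
have lA : l A by rewrite e; exact: lin_l.
have [|Y [h nY]] := @bt_extend X A; first by move=> XA; apply: nX; rewrite XA.
by exists Y; exact: opposite_bt lA _ _ h.
Qed.

Lemma half_plane_side l X : is_lin l -> ~ l X ->
  half_plane bt l [set Y | side l X Y].
Proof.
move=> hl nX; split; first exact/is_linP.
have [h1 [h2 s]] := is_lin_sep hl.
have [[e e0 ne cv] cr] := s; have d := sep_disj s.
have cov : h1 X \/ h2 X by suff : (h1 `|` h2) X by []; rewrite -e.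
have sw : separates bt l h2 h1.
  split; first by rewrite /convex_split setUC setIC; split=> //; exact/and_comm.
  move=> C D hC hD; have [Z [[hZ lZ] u]] := cr _ _ hD hC.
  exists Z; split; first by split=> //; exact: bt_sym.
  by move=> W [hW lW]; apply: u; split=> //; exact: bt_sym.
case: cov => hX; [exists h2|exists h1].
- suff -> : [set Y | side l X Y] = h1 by [].
  apply/seteqP; split=> Y /=; rewrite (sep_side _ _ s); last by left.
  by case=> -[] // /(d _ hX).
- suff -> : [set Y | side l X Y] = h2 by [].
  apply/seteqP; split=> Y /=; rewrite (sep_side _ _ s); last by right.
  by case=> -[] // /d/(_ hX).
Qed.

(** * Motions *)

Notation iso := (isomorphism bt bt).

Lemma iso_inj f : iso f -> injective f.
Proof. by move=> [/bij_inj]. Qed.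

Lemma iso_surj f B : iso f -> exists A, f A = B.
Proof. by move=> [[g _ gK] _]; exists (g B). Qed.

Lemma iso_bt f A B C : iso f -> bt (f A) (f B) (f C) = bt A B C.
Proof.
move=> hf; have e := congr1 (fun S : set T => S (f A)) (hf.2 B C).
rewrite /segment /= in e; rewrite -e; apply/propext.
by split=> [[X h /(iso_inj hf) <-] //|h]; exists A.
Qed.

Lemma isoP f : bijective f ->
  (forall A B C, bt (f A) (f B) (f C) <-> bt A B C) -> iso f.
Proof.
move=> hf h; split=> // A B; apply/seteqP; split=> [_ [X hX <-]|X hX].
  exact/h.
have [g fK gK] := hf; exists (g X); last exact: gK.
by apply/h; rewrite gK.
Qed.

Lemma iso_comp f g : iso f -> iso g -> iso (f \o g).
Proof.
move=> hf hg; apply: isoP; first exact: bij_comp hf.1 hg.1.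
by move=> A B C /=; rewrite !iso_bt.
Qed.

Lemma iso_inv f g : iso f -> cancel f g -> cancel g f -> iso g.
Proof.
move=> hf fK gK; apply: isoP; first by exists f.
by move=> A B C; rewrite -(iso_bt _ _ _ hf) !gK.
Qed.

Lemma iso_lin f A B X : iso f -> lin (f A) (f B) (f X) = lin A B X.
Proof. by move=> hf; rewrite /lin /= !iso_bt. Qed.

Lemma iso_halfline f A B X : iso f ->
  halfline (f A) (f B) (f X) = halfline A B X.
Proof. by move=> hf; rewrite /halfline /= !iso_bt. Qed.

Lemma iso_side f A B X Y : iso f ->
  side (lin (f A) (f B)) (f X) (f Y) = side (lin A B) X Y.
Proof.
move=> hf; rewrite /side !iso_lin //; apply/propext.
split=> -[nX nY h]; split=> // Z.
- by move: (h (f Z)); rewrite iso_bt // iso_lin.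
- by have [W <-] := iso_surj Z hf; rewrite iso_bt // iso_lin //; exact: h.
Qed.

Lemma iso_opposite f A B X Y : iso f ->
  opposite (lin (f A) (f B)) (f X) (f Y) = opposite (lin A B) X Y.
Proof.
move=> hf; rewrite /opposite !iso_lin //; apply/propext.
split=> -[nX nY [Z hZ lZ]]; split=> //; last first.
  by exists (f Z); rewrite ?iso_bt ?iso_lin.
move: hZ lZ; have [W <-] := iso_surj Z hf.
by rewrite iso_bt // iso_lin //; exists W.
Qed.

Lemma I_group : isomorphism_subgroup bt I.
Proof. by have [[]] := euclidean_bt. Qed.

Lemma I_iso f : I f -> iso f.
Proof. by have [h _ _ _] := I_group; exact: h. Qed.

Lemma I_comp f g : I f -> I g -> I (f \o g).
Proof. by have [_ _ h _] := I_group; exact: h. Qed.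

Lemma I_inv f : I f -> exists g, [/\ I g, cancel f g & cancel g f].
Proof. by have [_ _ _ h] := I_group; exact: h. Qed.

(** A half-line is no segment, because a segment from [A] can be prolonged. It is maximal because in
    a larger ray any extra point shares a segment with [A] and [B]; [A] must be an endpoint of that
    segment, which puts the extra point on the half-line. *)
Lemma maximal_ray_halfline A B : A <> B -> maximal_ray bt (halfline A B).
Proof.
move=> nAB; have cvx : convex bt (halfline A B).
  move=> X Y hX hY Z hZ.
  have s V W : halfline A B W -> bt Z V W -> bt V A W -> halfline A B Z.
    move=> hW hZ' hVW; have [WA|nW] := pselect (W = A).
      rewrite WA in hVW hZ'; move: hZ'; rewrite (bt_id hVW) => /bt_id ->.
      exact: halfline_l.
    rewrite -(halflineE nAB nW hW); left; exact: bt_subr hVW hZ'.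
  case: (halfline_total nAB hX hY) => h; first exact: s hZ h.
  exact: s (bt_sym hZ) h.
have tri X Y Z : halfline A B X -> halfline A B Y -> halfline A B Z ->
    exists W, [/\ halfline A B W, bt X A W, bt Y A W & bt Z A W].
  have two V W : halfline A B V -> halfline A B W ->
      exists U, [/\ halfline A B U, bt V A U & bt W A U].
    move=> hV hW; case: (halfline_total nAB hV hW) => h.
      by exists W; split=> //; exact: bt_r.
    by exists V; split=> //; exact: bt_r.
  move=> hX hY hZ; have [U [hU XU YU]] := two _ _ hX hY.
  have [W [hW UW ZW]] := two _ _ hU hZ.
  by exists W; split=> //; exact: bt_sub UW _.
exists A; split.
  split=> //.
  - split; first exact: halfline_l.
    by move=> X Y hX hY nX nY; exact: halfline_end nAB nX nY hX hY.
  - move=> X Y Z hX hY hZ; have [W [hW ? ? ?]] := tri _ _ _ hX hY hZ.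
    exists A, W; split=> //; move=> V; apply: cvx => //; exact: halfline_l.
  - move=> [X [Y e]].
    have bad W : ~ halfline A B = segment bt A W.
      move=> e'; have hW : halfline A B W by rewrite e'; exact: bt_r.
      have hB : segment bt A W B by rewrite -e'; exact: halfline_r.
      have nAW : A <> W by move=> AW; rewrite /segment /= -AW in hB; exact/nAB/esym/bt_id.
      have [V [hV nV]] := bt_extend nAW.
      have : segment bt A W V.
        rewrite -e' -(halflineE nAB (nesym nAW) hW); right; exact: hV.
      by move=> /(bt_anti hV)/esym.
    have hX : halfline A B X by rewrite e; exact: bt_l.
    have hY : halfline A B Y by rewrite e; exact: bt_r.
    have hA : bt A X Y by suff : segment bt X Y A by []; rewrite -e; exact: halfline_l.
    have [XA|nX] := pselect (X = A); first by apply: (bad Y); rewrite e XA.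
    have [YA|nY] := pselect (Y = A).
      apply: (bad X); rewrite e YA.
      by apply/seteqP; split=> ? /bt_sym.
    by case: (halfline_end nAB nX nY hX hY).
move=> r' [cv [r'A end_] three _] [s /existsNP[X /not_implyP[r'X nX]]].
have [U [V [sUV hA hB hX]]] := three A B X r'A (s _ (halfline_r A B)) r'X.
have bad W : bt B A W -> bt X A W -> False.
  move=> hB' hX'; case: (proj1 (bt_union B hX') hB') => h; first by apply: nX; right.
  by apply: nX; left; apply: bt_sym; apply: (bt_inner (bt_sym hX')); exact: bt_sym.
have [UA|nU] := pselect (U = A); first by rewrite UA in hB hX; exact: bad hB hX.
have [VA|nV] := pselect (V = A).
  by rewrite VA in hB hX; exact: bad (bt_sym hB) (bt_sym hX).
by apply: (end_ _ _ _ _ nU nV hA); apply: sUV; [exact: bt_l|exact: bt_r].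
Qed.

Lemma flag_side A B X : A <> B -> ~ lin A B X ->
  flag bt [set Y | side (lin A B) X Y] (halfline A B).
Proof.
move=> nAB nX; exists (lin A B); split.
- by apply: half_plane_side => //; exact: is_lin_lin.
- exact: maximal_ray_halfline.
- exact: halfline_lin.
Qed.

Lemma iso_image f (S S' : set T) : iso f -> (forall X, S' (f X) = S X) ->
  f @` S = S'.
Proof.
move=> hf h; apply/seteqP; split=> [_ [X hX <-]|X]; first by rewrite h.
by have [Y <-] := iso_surj X hf; rewrite h => hY; exists Y.
Qed.

(** Existence part of the flag axiom, in terms of points. The axiom moves rays only as sets; if
    [f A] were not [C], it would lie strictly between [C] and another point of the image ray, and
    pulling back would put [A] between two other points of its own ray. *)
Lemma motion_ex A B X C D Y : A <> B -> ~ lin A B X -> C <> D ->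
  ~ lin C D Y ->
  exists f, [/\ I f, f A = C, halfline C D (f B) & side (lin C D) Y (f X)].
Proof.
move=> nAB nX nCD nY; have [_ _ h] := proj1 euclidean_bt.
have [f [[If sf rf] _]] := h _ _ _ _ (flag_side nAB nX) (flag_side nCD nY).
have hf := I_iso If; exists f; split=> //.
- have hfA Z : halfline A B Z -> halfline C D (f Z) by move=> hZ; rewrite -rf; exists Z.
  have : halfline C D C by exact: halfline_l.
  rewrite -rf => -[A' hA' fA']; apply: contrapT => nfA.
  have [E [hE nE]] := bt_extend (nesym nfA).
  have nE' : E <> C by move=> e; rewrite e in hE; exact/nfA/bt_id.
  have : halfline C D E.
    by rewrite -(halflineE nCD nfA (hfA _ (halfline_l A B))); right.
  rewrite -rf => -[E' hE' fE'].
  have nA' : A' <> A by move=> e; apply: nfA; rewrite -e.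
  have nEA : E' <> A by move=> e; apply: nE; rewrite -fE' e.
  apply: (halfline_end nAB nA' nEA hA' hE').
  by rewrite -(iso_bt _ _ _ hf) fA' fE'.
- by rewrite -rf; exists B => //; exact: halfline_r.
- suff : [set Z | side (lin C D) Y Z] (f X) by [].
  by rewrite -sf; exists X => //; exact: side_refl.
Qed.

(** Uniqueness part of the flag axiom: [f] and [id] both preserve the flag of [A], [B], [X]. The
    images of [B] and [X] need only be located on a ray and on a side, not computed. *)
Lemma motion_id f A B X Z : I f -> A <> B -> f A = A -> halfline A B (f B) ->
  side (lin A B) X (f X) -> f Z = Z.
Proof.
move=> If nAB fA hB hX; have hf := I_iso If; have [nX _ _] := hX.
have nfB : f B <> A by rewrite -fA => /(iso_inj hf)/esym.
have eh := halflineE nAB nfB hB.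
have el : lin A (f B) = lin A B.
  by rewrite -(lin_in nAB (nesym nfB)) //; [exact: lin_l|exact: halfline_lin].
have [_ _ h] := proj1 euclidean_bt.
have [g [_ u]] := h _ _ _ _ (flag_side nAB nX) (flag_side nAB nX).
have [_ Iid _ _] := I_group.
have gf : g = f.
  apply: u; split=> //; apply: iso_image => // W.
  - rewrite /= -(iso_side A B X W hf) fA el; apply/propext.
    have hl := is_lin_lin nAB.
    split; last exact: side_trans hX.
    by apply: side_trans; [|exact: side_sym].
  - by rewrite -(iso_halfline A B W hf) fA eh.
by rewrite -gf (u id) //; split=> //; rewrite image_id.
Qed.

(** * Half-turns *)

(** Crossbar argument. With [B'] beyond [A] from [B], the second assumption makes the segment from
    [X] to [B'] cross the line [A Y] at some [Z] on the ray of [Y]. Then [B], [Y], [Z], [B'] are all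
    on one side of [A X], although [A] separates [B] from [B']. *)
Lemma angle_order A B X Y : A <> B -> side (lin A B) X Y -> ~ lin A X Y ->
  side (lin A X) B Y -> ~ side (lin A Y) B X.
Proof.
move=> nAB hXY nXY h1 h2.
have [nX nY _] := hXY; have hl := is_lin_lin nAB.
have nAX : A <> X by move=> e; apply: nX; rewrite -e; exact: lin_l.
have nAY : A <> Y by move=> e; apply: nY; rewrite -e; exact: lin_l.
have hlX := is_lin_lin nAX; have hlY := is_lin_lin nAY.
have [nB1 _ _] := h1; have [nB2 nX2 _] := h2.
have [B' [hB' nB']] := bt_extend (nesym nAB).
have lB' : lin A B B' by constructor 2.
have oX := opposite_bt hlX (lin_l A X) nB1 nB' hB'.
have oY := opposite_bt hlY (lin_l A Y) nB2 nB' hB'.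
have [_ nB'Y [Z hZ lZ]] := side_opposite hlY (side_sym h2) oY.
have nZB' : Z <> B' by move=> e; apply: nB'Y; rewrite -e.
have nZX : Z <> X by move=> e; apply: nX2; rewrite -e.
have s1 : side (lin A B) X Z.
  by apply: (side_halfline hl lB') => //; left; exact: bt_sym.
have s2 : side (lin A B) Y Z by exact: side_trans (side_sym hXY) s1.
have nZ : ~ lin A B Z by case: s1.
have nZA : Z <> A by move=> e; apply: nZ; rewrite e; exact: lin_l.
have s3 : side (lin A X) Y Z.
  apply: (side_halfline hlX (lin_l A X)) => //; case: (lin_halfline lZ) => // h.
  by case: (side_not_opposite s2); exact: opposite_bt (lin_l A B) nY nZA h.
have nB'X : ~ lin A X B' by case: oX.
have s4 : side (lin A X) B' Z.
  by apply: (side_halfline hlX (lin_r A X)) => //; left.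
have := side_trans hlX h1 (side_trans hlX s3 (side_sym s4)).
by move/side_not_opposite.
Qed.

Definition half_turn A f := [/\ I f, f A = A, involutive f & forall X, bt A X (f X)].

Lemma half_turn_ex A : exists f, half_turn A f.
Proof.
have [B nAB] : exists B, A <> B.
  have [_ [B [C nBC]] _] := plane_bt.
  by have [e|?] := pselect (A = B); [exists C; rewrite e|exists B].
have hl := is_lin_lin nAB; have [X nX] := is_lin_off hl.
have [B' [hB' nB']] := bt_extend (nesym nAB).
have lB' : lin A B B' by constructor 2.
have [X' oX] := opposite_ex hl nX.
have el : lin A B' = lin A B by rewrite -(lin_in nAB (nesym nB') (lin_l A B)).
have nX' : ~ lin A B' X' by rewrite el; case: oX.
have [f [If fA fB fX]] := motion_ex nAB nX (nesym nB') nX'.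
have hf := I_iso If; rewrite el in fX.
have nfB : f B <> A by rewrite -fA => /(iso_inj hf)/esym.
have bB : bt A B (f B).
  by apply: bt_sym; apply: halfline_opp fB _; [exact: nesym|exact: bt_sym].
have oX' : opposite (lin A B) X (f X).
  by apply/opposite_sym/(side_opposite hl (side_sym fX)); exact: opposite_sym.
have lfB : lin A B (f B) by constructor 2; exact: bB.
have elf : lin A (f B) = lin A B by rewrite -(lin_in nAB (nesym nfB) (lin_l A B)).
(* [f] reverses the ray of [B] and exchanges the sides of its line, so its square preserves the
   original flag. *)
have ff Z : f (f Z) = Z.
  apply: (@motion_id (f \o f) A B X) => //=.
  - exact: I_comp.
  - by rewrite !fA.
  - apply: (opp_opp nfB bB); rewrite -{1}fA iso_bt //; exact: bB.
  - apply: (opposite_opposite hl oX').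
    by rewrite -elf -{1}fA iso_opposite.
exists f; split=> // Y.
(* One point thrown to the opposite ray suffices for its whole ray; applied to [B] and to [f B],
   this settles the line [A B]. *)
have gen Y' Z : Y' <> A -> bt A Y' (f Y') -> halfline A Y' Z -> bt A Z (f Z).
  move=> nY' hY' hZ; have hfZ : halfline A (f Y') (f Z).
    by rewrite -{1}fA iso_halfline.
  apply/bt_sym/(halfline_opp _ hfZ).
    by rewrite -{1}fA => /(iso_inj hf)/esym.
  by apply: bt_sym; apply: halfline_opp hZ hY'; exact: nesym.
have [lY|nY] := pselect (lin A B Y).
  case: (lin_halfline lY) => h; first exact: gen (nesym nAB) bB h.
  apply: (gen (f B)) => //; first by rewrite ff; exact: bt_sym.
  exact: opp_opp (nesym nAB) (bt_sym bB) h.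
have nYA : Y <> A by move=> e; apply: nY; rewrite e; exact: lin_l.
have nfY : f Y <> A by rewrite -fA => /(iso_inj hf).
(* Suppose f Y is off the line A Y and extend f Y A to W. If C is one of B, B'
   and lies on the W side of A Y, applying f shows that C lies on the Y side of
   A W, against angle_order. *)
apply: contrapT => hb.
have oY : opposite (lin A B) Y (f Y).
  case: (side_or_opposite nX nY) => h.
    have h' : side (lin A B) (f X) (f Y) by rewrite -elf -{1}fA iso_side.
    have oYX := side_opposite hl (side_sym h) oX'.
    exact/opposite_sym/(side_opposite hl (side_sym h'))/opposite_sym.
  have h' : opposite (lin A B) (f X) (f Y) by rewrite -elf -{1}fA iso_opposite.
  have h2 := opposite_opposite hl (opposite_sym h) oX'.
  exact: side_opposite h2 h'.
have [W [hW nW]] := bt_extend nfY.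
have nlfY : ~ lin A B (f Y) by case: oY.
have oW := opposite_bt hl (lin_l A B) nlfY nW hW.
have sW : side (lin A B) Y W by exact: opposite_opposite oY oW.
have nWf : ~ lin A Y (f Y).
  case/lin_halfline => // h.
  have := side_halfline hl (lin_l A B) nY nfY h.
  by move/side_not_opposite.
have elW : lin A W = lin A (f Y).
  apply: lin_in => //; [exact: nesym|exact: nesym|exact: lin_l|].
  by constructor 2; exact: bt_sym.
have nlY : ~ lin A Y W.
  move=> h; apply: nWf; rewrite (lin_in (nesym nYA) (nesym nW) (lin_l A Y) h) elW.
  exact: lin_r.
have hfW : bt A Y (f W) by rewrite -(ff Y) -fA iso_bt // fA.
have hlY := is_lin_lin (nesym nYA); have hlW := is_lin_lin (nesym nW).
have nfW : f W <> A by rewrite -fA => /(iso_inj hf).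
have nYW : ~ lin A W Y.
  move=> h; apply: nlY; rewrite -(lin_in (nesym nW) (nesym nYA) (lin_l A W) h).
  exact: lin_r.
have oYfW := opposite_bt hlW (lin_l A W) nYW nfW hfW.
have key C C' : lin A B C -> A <> C -> C' <> A -> bt A C C' ->
    halfline A C' (f C) -> ~ side (lin A Y) C W.
  move=> lC nAC nC' hC hfC s.
  have elC := lin_in nAB nAC (lin_l A B) lC.
  have s' : side (lin A W) (f C) (f W) by rewrite elW -{1}fA iso_side.
  have nfC : f C <> A by rewrite -fA => /(iso_inj hf)/esym.
  have hC2 : bt A (f C) C by exact: halfline_opp (nesym nC') hfC (bt_sym hC).
  have nlfC : ~ lin A W (f C) by case: s'.
  have o := opposite_bt hlW (lin_l A W) nlfC (nesym nAC) hC2.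
  have s2 := side_opposite hlW (side_sym s') o.
  have sCY : side (lin A W) C Y.
    exact: opposite_opposite (opposite_sym s2) (opposite_sym oYfW).
  by apply: (angle_order nAC _ nlY s sCY); rewrite -elC.
have nYB : ~ lin A Y B.
  move=> h; apply: nY; rewrite -(lin_in (nesym nYA) nAB (lin_l A Y) h).
  exact: lin_r.
have oB := opposite_bt hlY (lin_l A Y) nYB nB' hB'.
case: (side_or_opposite nYB nlY) => h; first exact: (key B B' (lin_r A B) nAB nB' hB' fB h).
apply: (key B' B lB' (nesym nB') (nesym nAB) (bt_sym hB')).
- by apply: (opp_opp nfB bB); rewrite -{1}fA iso_bt.
- exact: opposite_opposite (opposite_sym oB) h.
Qed.

(** * Completeness and midpoints *)

(** Dedekind completeness out of connectedness: cut the segment into the points below some member of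
    [S] and the rest. Whichever piece is a closed segment has the supremum as its endpoint at the
    cut; if the cut is improper, then [B] itself is in [S]. *)
Lemma segment_lub A B (S : set T) : A <> B -> S `<=` segment bt A B ->
  S !=set0 ->
  exists M, [/\ bt M A B, forall X, S X -> bt X A M
    & forall N, bt N A B -> (forall X, S X -> bt X A N) -> bt M A N].
Proof.
move=> nAB SAB [X0 SX0].
pose c1 := [set X | bt X A B /\ exists2 Y, S Y & bt X A Y].
pose c2 := segment bt A B `\` c1.
have tot X Y : bt X A B -> bt Y A B -> bt X A Y \/ bt Y A X.
  by move=> hX hY; apply: (halfline_total nAB); left.
have c1S X : S X -> c1 X by move=> SX; split; [exact: SAB|exists X => //; exact: bt_r].
have c1A : c1 A by split; [exact: bt_l|exists X0 => //; exact: bt_l].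
have [c2B|nc2B] := pselect (c2 B); last first.
  have [_ [Y SY hY]] : c1 B by apply: contrapT => h; apply: nc2B; split=> //; exact: bt_r.
  have YB := bt_anti (SAB _ SY) hY.
  by exists B; split=> [||N _]; [exact: bt_r|exact: SAB|apply; rewrite -YB].
have c2E X : bt X A B -> c1 X \/ c2 X.
  by move=> hX; have [h|h] := pselect (c1 X); [left|right].
have dn X Y : c1 Y -> bt X A Y -> c1 X.
  move=> [hY [Z SZ hZ]] hX; split; first exact: bt_sub hY hX.
  by exists Z => //; exact: bt_sub hZ hX.
have up X Y : c2 X -> bt X A Y -> bt Y A B -> c2 Y.
  by move=> [hX nX] hXY hY; split=> // /dn/(_ hXY).
have segE X Y Z : bt X A Y -> bt Z X Y -> bt Z A Y /\ bt X A Z.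
  move=> hX hZ; split; first exact: bt_subr hX hZ.
  by apply: bt_sym; apply: (bt_inner (bt_sym hX)); exact: bt_sym.
have split12 : convex_split bt (segment bt A B) c1 c2.
  split.
  - apply/seteqP; split=> [X /c2E //|X []]; by case.
  - by apply/seteqP; split => // X [? []].
  - by split; [exists A|exists B].
  - split=> X Y hX hY Z hZ.
    + case: (tot X Y hX.1 hY.1) => h; first exact: dn hY (segE _ _ _ h hZ).1.
      exact: dn hX (segE _ _ _ h (bt_sym hZ)).1.
    + case: (tot X Y hX.1 hY.1) => h.
        have [h1 h2] := segE _ _ _ h hZ.
        by apply: up hX h2 _; exact: bt_sub hY.1 h1.
      have [h1 h2] := segE _ _ _ h (bt_sym hZ).
      by apply: up hY h2 _; exact: bt_sub hX.1 h1.
have cl1 : closed_segment bt c1 -> exists2 Q, c1 = segment bt A Q & c1 Q.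
  move=> [P [Q e]].
  have [cP cQ] : c1 P /\ c1 Q by rewrite e; split; [exact: bt_l|exact: bt_r].
  have hA : bt A P Q by suff : segment bt P Q A by []; rewrite -e.
  case: (tot P Q cP.1 cQ.1) => h.
  - have PA : P = A by apply: (bt_anti (A := Q)); exact: bt_sym.
    by exists Q => //; rewrite e PA.
  - have QA : Q = A by apply: (bt_anti (A := P)) => //; exact: bt_sym.
    exists P => //; rewrite e QA; apply/seteqP; split=> ?; exact: bt_sym.
case: (connected_bt nAB split12) => -[h1 h2].
- have [Q e cQ] := cl1 h1; exists Q; split; first exact: cQ.1.
    by move=> X /c1S; rewrite e.
  by move=> N hN ub; have [_ [Y SY hY]] := cQ; exact: bt_sub (ub _ SY) hY.
- have [P [Q e]] := h2.
  have [cP cQ] : c2 P /\ c2 Q by rewrite e; split; [exact: bt_l|exact: bt_r].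
  have hB : bt B P Q by suff : segment bt P Q B by []; rewrite -e.
  have [M e' cM] : exists2 M, c2 = segment bt M B & c2 M.
    case: (tot P Q cP.1 cQ.1) => h.
    - exists P => //; rewrite e; congr segment.
      by apply: (bt_anti (A := A)); [exact: cQ.1|exact: (segE _ _ _ h hB).1].
    - exists Q => //; rewrite e.
      have -> : P = B.
        by apply: (bt_anti (A := A)); [exact: cP.1|exact: (segE _ _ _ h (bt_sym hB)).1].
      by apply/seteqP; split=> ?; exact: bt_sym.
  exists M; split; first exact: cM.1.
  - move=> X SX; case: (tot X M (SAB _ SX) cM.1) => // h.
    by case: cM => _ []; exact: dn (c1S _ SX) h.
  - move=> N hN ub; case: (tot M N cM.1 hN) => // h.
    (* An upper bound [N] inside [c1] would make [c1] the closed segment from [A] to [N], but here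
       only [c2] is closed. *)
    case: (c2E N hN) => cN; last first.
      have hN' : bt N M B by suff : segment bt M B N by []; rewrite -e'.
      by apply: bt_sym; apply: (bt_inner (bt_sym cM.1)); exact: bt_sym.
    case: h1; exists A, N; apply/seteqP; split=> [X [hX [Y SY hY]]|X].
      exact: bt_sub (ub _ SY) hY.
    exact: dn.
Qed.

(* The fixed point is the supremum of the X with X <= g X, where X <= Y on the
   half-line from P means that X is between P and Y. *)
Lemma antitone_fixpoint P Q g : P <> Q -> iso g -> g Q = P ->
  halfline P Q (g P) -> exists2 M, bt M P Q & g M = M.
Proof.
move=> nPQ hg gQ hgP.
have ngP : g P <> P by rewrite -{2}gQ => /(iso_inj hg).
have hl X : bt X P Q -> halfline P Q (g X).
  move=> hX; rewrite -(halflineE nPQ ngP hgP); left.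
  by apply: bt_sym; rewrite -{2}gQ iso_bt.
have tot X Y : halfline P Q X -> halfline P Q Y -> bt X P Y \/ bt Y P X.
  exact: halfline_total.
have anti X Y : bt X P Y -> bt Y P Q -> bt (g Y) P (g X).
  by move=> hX hY; apply: bt_sym; rewrite -{1}gQ iso_bt //; exact: bt_inner hY hX.
pose S := [set X | bt X P Q /\ bt X P (g X)].
have [|||M [hM ub lub]] := @segment_lub P Q S => //.
- by move=> X [].
- by exists P; split; exact: bt_l.
have seg X : bt X P Q -> halfline P Q X by left.
have nS X : bt X P Q -> ~ S X -> bt (g X) P X /\ g X <> X.
  move=> hX h; split; last by move=> e; apply: h; split=> //; rewrite e; exact: bt_r.
  by case: (tot _ _ (seg _ hX) (hl _ hX)) => // h'; case: h.
have noS X : bt X P Q -> bt M P X -> X <> M -> ~ S X.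
  by move=> hX hMX nX SX; apply: nX; exact: bt_anti (ub _ SX) hMX.
(* Points beyond [M] are outside [S], so [g] moves them down. If [N] and [g N] were both beyond [M],
   then [g (g N)] would be strictly below [g N], whereas antitonicity applied to [g N] below [N]
   gives the reverse. *)
have no N : bt N P Q -> bt M P N -> N <> M -> bt M P (g N) -> g N <> M -> False.
  move=> hN hMN nN hMg ng.
  have [h1 _] := nS _ hN (noS _ hN hMN nN).
  have hgN := bt_sub hN h1.
  have [h2 n2] := nS _ hgN (noS _ hgN hMg ng).
  by apply: n2; apply: bt_anti h2 _; exact: anti h1 hN.
exists M => //; apply: contrapT => ngM.
(* Suppose [g M] is beyond [M]. A point [N] strictly between [M] and both [g M] and [Q] has [g N] at
   most [M], so its preimage [K] lies between [M] and [N], and [K] together with [g K = N]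
   contradicts [no]. *)
case: (tot _ _ (hl _ hM) (seg _ hM)) => h; last first.
  have nMQ : M <> Q by move=> e; rewrite e gQ in h; apply: nPQ; rewrite (bt_id h).
  have [U [hU hUQ hUg nMU]] : exists U, [/\ bt M P U, bt U P Q, bt U P (g M) & M <> U].
    case: (tot _ _ (hl _ hM) (halfline_r P Q)) => h'.
      by exists (g M); split=> //; [exact: bt_r|exact: nesym].
    by exists Q; split=> //; exact: bt_r.
  have [N [hN nNM nNU]] := bt_dense nMU.
  have hNU : bt N P U by exact: bt_subr hU hN.
  have hMN : bt M P N by apply: bt_sym; apply: (bt_inner (bt_sym hU)); exact: bt_sym.
  have hNQ := bt_sub hUQ hNU; have hNg := bt_sub hUg hNU.
  have hgN : bt (g N) P M.
    have [->|n] := pselect (g N = M); first exact: bt_r.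
    case: (tot _ _ (seg _ hM) (hl _ hNQ)) => // hgN.
    by case: (no N).
  have [K eK] := iso_surj N hg.
  have hK : bt K M N.
    rewrite -(iso_bt _ _ _ hg) eK; apply: bt_sym.
    exact: bt_inner hNg (bt_sub hMN hgN).
  have hKQ : bt K P Q by apply: bt_sub hNQ _; exact: bt_subr hMN hK.
  have hMK : bt M P K by apply: bt_sym; apply: (bt_inner (bt_sym hMN)); exact: bt_sym.
  apply: (no K) => //; rewrite ?eK //.
  move=> e; rewrite e in eK; apply: nNU; rewrite -eK in hUg *.
  by apply: bt_anti hUg; rewrite eK.
(* Now [g M] is strictly below [M]. Take [Y] strictly between them, [X] in [S] not below [Y], the
   preimage [K] of [Y], and [X'] in [S] strictly beyond [K]. Then [X'] is at most [g X'], which is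
   at most [g K = Y], hence at most [X] and at most [K], a contradiction. *)
have [Y [hY nYg nYM]] := bt_dense ngM.
have hYM : bt Y P M by exact: bt_subr h hY.
have hgY : bt (g M) P Y by apply: bt_sym; apply: (bt_inner (bt_sym h)); exact: bt_sym.
have notub N : bt N P M -> N <> M -> exists2 X, S X & bt N P X /\ ~ bt X P N.
  move=> hN nN; apply: contrapT => hX; apply: nN; apply: bt_anti (hN) _.
  apply: lub; first exact: bt_sub hM hN.
  move=> X SX; apply: contrapT => hXN; apply: hX; exists X => //; split=> //.
  by case: (tot X N (seg _ SX.1) (seg _ (bt_sub hM hN))).
have [X SX [hYX _]] := notub Y hYM nYM.
have hXM := ub _ SX.
have [K eK] := iso_surj Y hg.
have hK : bt K X M.
  rewrite -(iso_bt _ _ _ hg) eK; apply: bt_sym.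
  exact: bt_inner (bt_sub SX.2 hYX) hgY.
have hKM : bt K P M by exact: bt_subr hXM hK.
have hXK : bt X P K by apply: bt_sym; apply: (bt_inner (bt_sym hXM)); exact: bt_sym.
have nKM : K <> M by move=> e; apply: nYg; rewrite -eK e.
have [X' SX' [hKX' nX']] := notub K hKM nKM.
apply: nX'; apply: bt_sub hXK _; apply: bt_sub hYX _; rewrite -eK.
by apply: bt_sub (anti _ _ hKX' SX'.1) _; exact: SX'.2.
Qed.

Lemma half_turn_opposite A f l X : half_turn A f -> is_lin l -> l A -> ~ l X ->
  opposite l X (f X).
Proof.
move=> [If fA ff hf] hl lA nX; apply: opposite_bt (hf X) => // e.
by apply: nX; rewrite -(ff X) e fA.
Qed.

(** Let [g] carry the ray from [A] through [B] to the ray from [B] through [A] and exchange the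
    sides. It reverses the order, so it fixes some [M] on the segment; the half-turn about [M]
    composed with [g] preserves a flag at [M], hence inverts [g]. *)
Lemma midpoint A B : A <> B -> exists M f, half_turn M f /\ f A = B.
Proof.
move=> nAB; have hl := is_lin_lin nAB; have [X nX] := is_lin_off hl.
have [Y oY] := opposite_ex hl nX; have nY : ~ lin B A Y by rewrite lin_sym; case: oY.
have [g [Ig gA hgB sg]] := motion_ex nAB nX (nesym nAB) nY.
have hg := I_iso Ig.
have [M hM gM] := antitone_fixpoint (nesym nAB) hg gA hgB.
have [f hf] := half_turn_ex M; have [If fM ff btf] := hf.
exists M, f; split=> //.
have nAM : A <> M by move=> e; apply: nAB; rewrite -gA e.
have nMB : M <> B by move=> e; apply: nAB; apply: (iso_inj hg); rewrite gA -e gM.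
have lM : lin A B M by constructor 1; exact: bt_sym.
have elM : lin M A = lin A B by rewrite (lin_in nAB nAM (lin_l A B) lM) lin_sym.
have fg Z : f (g Z) = Z.
  apply: (@motion_id (f \o g) M A X) => //=.
  - exact: I_comp.
  - exact: nesym.
  - by rewrite gM.
  - by apply: (opp_opp (nesym nMB)); [exact: bt_sym hM|rewrite gA].
  - rewrite elM; have oX : opposite (lin A B) X (g X).
      rewrite lin_sym in sg.
      by apply/opposite_sym/(side_opposite hl (side_sym sg)); exact: opposite_sym.
    apply: (opposite_opposite hl oX); apply: half_turn_opposite hf hl lM _.
    by case: oX.
by rewrite -{1}(fg A) ff gA.
Qed.

(** * Translations *)

Lemma parallel_sym l m : parallel l m -> parallel m l.
Proof. by case=> [->|h]; [left|right; rewrite setIC]. Qed.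

Lemma parallel_meet l m X : parallel l m -> l X -> m X -> l = m.
Proof.
case=> // e lX mX; have : (l `&` m) X by [].
by rewrite e.
Qed.

Lemma parallel_ex l A : is_lin l ->
  exists m, [/\ is_lin m, m A & parallel m l].
Proof.
move=> [B [C [n ->]]]; have [_ h] := euclidean_bt.
have [m [[hm mA hp] _]] := h _ _ _ n (lin_largest n) A.
by exists m; split=> //; exact/is_linP.
Qed.

Lemma parallel_uniq l m m' A : is_lin l -> is_lin m -> is_lin m' ->
  m A -> m' A -> parallel m l -> parallel m' l -> m = m'.
Proof.
move=> [B [C [n ->]]] /is_linP hm /is_linP hm' mA mA' hp hp'.
have [_ h] := euclidean_bt.
have [k [_ u]] := h _ _ _ n (lin_largest n) A.
by rewrite -(u m) // -(u m').
Qed.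

Lemma parallel_trans l m n : is_lin l -> is_lin m -> is_lin n ->
  parallel l m -> parallel m n -> parallel l n.
Proof.
move=> hl hm hn lm mn; have [e|[X [lX nX]]] : l `&` n = set0 \/ (l `&` n) !=set0.
- by have [/eqP e|/set0P h] := boolP (l `&` n == set0); [left|right].
- by right.
- by left; apply: (parallel_uniq hm hl hn lX nX lm); exact: parallel_sym.
Qed.

Definition dilatation f :=
  iso f /\ forall A B, A <> B -> parallel (lin (f A) (f B)) (lin A B).

Lemma iso_neq f A B : iso f -> A <> B -> f A <> f B.
Proof. by move=> hf n /(iso_inj hf). Qed.

Lemma dilatation_comp f g : dilatation f -> dilatation g -> dilatation (f \o g).
Proof.
move=> [hf df] [hg dg]; split; first exact: iso_comp.
move=> A B n; have ng := iso_neq hg n; have nf := iso_neq hf ng.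
by apply: parallel_trans (df _ _ ng) (dg _ _ n); exact: is_lin_lin.
Qed.

Lemma dilatation_inv f g : dilatation f -> cancel f g -> cancel g f ->
  dilatation g.
Proof.
move=> [hf df] fK gK; have hg := iso_inv hf fK gK; split=> // A B n.
by have := df _ _ (iso_neq hg n); rewrite !gK => /parallel_sym.
Qed.

Lemma dilatation_conj f t g : dilatation t -> iso f -> cancel f g ->
  cancel g f -> dilatation (f \o t \o g).
Proof.
move=> [ht dt] hf fK gK; have hg := iso_inv hf fK gK.
split; first by apply: iso_comp => //; exact: iso_comp.
move=> A B n; have ng := iso_neq hg n.
case: (dt _ _ ng) => e; [left|right].
- apply/funext => X; rewrite -(gK X) /= iso_lin // e.
  by rewrite -(iso_lin _ _ _ hf) !gK.
- apply/seteqP; split=> // X [] /=.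
  rewrite -(gK X) iso_lin // -[lin A B _](iso_lin _ _ _ hg) fK => h1 h2.
  suff : (lin (t (g A)) (t (g B)) `&` lin (g A) (g B)) (g X) by rewrite e.
  by [].
Qed.

(** If a line meets its image in [X], it contains [X] and [f X], hence the point [A] between them;
    and a line through [A] is mapped to itself. *)
Lemma half_turn_dilatation A f : half_turn A f -> dilatation f.
Proof.
move=> [If fA ff hf]; have fi := I_iso If; split=> // B C n.
have hl := is_lin_lin n; have hm := is_lin_lin (iso_neq fi n).
have [lA|nA] := pselect (lin B C A); last first.
  right; apply/seteqP; split=> // X [mX lX]; apply: nA.
  apply: (is_lin_convex hl lX _ (hf X)).
  by rewrite -(iso_lin _ _ _ fi) ff.
have st X : lin B C X -> lin B C (f X).
  move=> lX; have [->|nX] := pselect (X = A); first by rewrite fA.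
  rewrite (lin_in n nX lX lA); constructor 3; exact: hf.
by left; apply/esym/lin_in; [|exact: iso_neq|apply/st/lin_l|apply/st/lin_r].
Qed.

Definition translation f :=
  dilatation f /\ ((forall X, f X = X) \/ forall X, f X <> X).

Lemma translation_id : translation id.
Proof.
split; last by left.
split; last by left.
by apply: isoP; [exists id|].
Qed.

(** Take for [g] the half-turn exchanging [A] and [B]. If [g \o f] fixed a point [P], then
    [f P = g P], and the line through [P] and [f P] would contain both centres; each half-turn
    exchanges its sides, so the product would preserve a flag at [P] and be the identity. *)
Lemma translation_half_turn A B f : half_turn A f ->
  exists M g, [/\ half_turn M g, translation (g \o f) & g A = B].
Proof.
move=> hf; have [If fA ff bf] := hf.
have [<-|nAB] := pselect (A = B).
  exists A, f; split=> //; rewrite (_ : f \o f = id).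
    exact: translation_id.
  by apply/funext => X /=.
have [M [g [hg gA]]] := midpoint nAB; have [Ig gM gg bg] := hg.
exists M, g; split=> //.
split; first by apply: dilatation_comp; apply: half_turn_dilatation; eassumption.
right=> P /= gfP.
have fP : f P = g P by rewrite -[RHS](congr1 g gfP) gg.
have [e|n] := pselect (P = f P).
  have AP : A = P by apply: bt_id; rewrite {2}e; exact: bf.
  by apply: nAB; rewrite -gA {2}AP -fP -e.
have hl := is_lin_lin n; have [X nX] := is_lin_off hl.
have lA : lin P (f P) A by constructor 1; exact: bf.
have lM : lin P (f P) M by constructor 1; rewrite fP; exact: bg.
have oX := half_turn_opposite hf hl lA nX.
have nfX : ~ lin P (f P) (f X) by case: oX.
have oX' := half_turn_opposite hg hl lM nfX.
apply: nAB; rewrite -gA -{2}fA; apply/esym.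
apply: (@motion_id (g \o f) P (f P) X) => //=.
- exact: I_comp.
- by rewrite ff -fP; exact: halfline_r.
- exact: opposite_opposite oX oX'.
Qed.

Lemma translation_ex A B : exists t, [/\ I t, translation t & t A = B].
Proof.
have [f hf] := half_turn_ex A; have [M [g [hg ht gA]]] := translation_half_turn B hf.
have [[If fA _ _] [Ig _ _ _]] := (hf, hg).
by exists (g \o f); split=> //=; [exact: I_comp|rewrite fA].
Qed.

(** Each line through a point and its image is invariant under [t], so two such lines meeting at [Z]
    also share [t Z]. *)
Lemma translation_trace t X Y : translation t -> t X <> X ->
  parallel (lin X (t X)) (lin Y (t Y)).
Proof.
move=> [[ht dt] [e|e]] nX; first by case: nX.
have inv Z W : lin Z (t Z) W -> lin Z (t Z) (t W).
  have nt : t Z <> t (t Z) by exact/nesym/e.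
  have el : lin (t Z) (t (t Z)) = lin Z (t Z).
    apply: (parallel_meet (dt _ _ (nesym (e Z)))); first exact: lin_l.
    exact: lin_r.
  by rewrite -{2}el iso_lin.
have [h|[Z [hX hY]]] : lin X (t X) `&` lin Y (t Y) = set0 \/
    (lin X (t X) `&` lin Y (t Y)) !=set0.
- by have [/eqP h|/set0P h] := boolP (lin X (t X) `&` lin Y (t Y) == set0); [left|right].
- by right.
- left; apply: (is_lin_eq _ _ (nesym (e Z)) hX (inv _ _ hX) hY (inv _ _ hY)).
  + exact/is_lin_lin/nesym.
  + exact/is_lin_lin/nesym.
Qed.

(* For X off the trace of A, the image of X lies on the parallel to A (t A)
   through X and on the parallel to A X through t A. *)
Lemma translation_uniq t t' A X : translation t -> translation t' ->
  t A = t' A -> t X = t' X.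
Proof.
move=> ht ht' e; have [[di fi] [di' fi']] := (ht, ht').
have [tA|nA] := pselect (t A = A).
  case: fi => [->|/(_ A)//]; case: fi' => [->//|/(_ A)].
  by rewrite -e tA.
have off Y Z : t Y = t' Y -> t Y <> Y -> ~ lin Y (t Y) Z -> t Z = t' Z.
  move=> eY nY nZ; have nYZ : Y <> Z by move=> h; apply: nZ; rewrite -h; exact: lin_l.
  have fix_ s : translation s -> s Y <> Y -> s Z <> Z.
    by move=> [_ [->|]].
  have nY' : t' Y <> Y by rewrite -eY.
  have [nZt nZt'] := (fix_ _ ht nY, fix_ _ ht' nY').
  have p1 := parallel_sym (translation_trace Z ht nY).
  have p1' := parallel_sym (translation_trace Z ht' nY').
  rewrite -eY in p1'.
  have e1 := parallel_uniq (is_lin_lin (nesym nY)) (is_lin_lin (nesym nZt))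
    (is_lin_lin (nesym nZt')) (lin_l _ _) (lin_l _ _) p1 p1'.
  have n2 := iso_neq di.1 nYZ; have n2' := iso_neq di'.1 nYZ.
  have p2 := di.2 _ _ nYZ; have p2' := di'.2 _ _ nYZ.
  have l2' : lin (t' Y) (t' Z) (t Y) by rewrite eY; exact: lin_l.
  have e2 := parallel_uniq (is_lin_lin nYZ) (is_lin_lin n2)
    (is_lin_lin n2') (lin_l _ _) l2' p2 p2'.
  apply: contrapT => n.
  have e3 : lin Z (t Z) = lin (t Y) (t Z).
    apply: (is_lin_eq _ _ n (lin_r _ _) _ (lin_r _ _)).
    - exact/is_lin_lin/nesym.
    - exact: is_lin_lin.
    - rewrite e1; exact: lin_r.
    - rewrite e2; exact: lin_r.
  apply: nZ; rewrite -(parallel_meet p1 (X := t Y)) //; first exact: lin_l.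
  - rewrite e3; exact: lin_l.
  - exact: lin_r.
have [lX|nX] := pselect (lin A (t A) X); last exact: off e nA nX.
have hl := is_lin_lin (nesym nA); have [Y nY] := is_lin_off hl.
have tY : t Y <> Y by case: fi => // h; case: nA.
apply: (off Y) => //; first exact: off e nA nY.
move=> h; apply: nY; rewrite (parallel_meet (translation_trace Y ht nA) lX h).
exact: lin_l.
Qed.

Lemma translation_inv t t' : translation t -> cancel t t' -> cancel t' t ->
  translation t'.
Proof.
move=> [dt ft] tK tK'; split; first exact: dilatation_inv dt tK tK'.
case: ft => h; [left=> X; by rewrite -{1}(h X) tK|right=> X e].
by apply: (h X); rewrite -{1}e tK'.
Qed.

(** If the product fixes [X], then [t'] agrees with the inverse of [t] at [X], hence everywhere. *)
Lemma translation_comp t t' : translation t -> translation t' ->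
  translation (t \o t').
Proof.
move=> ht ht'; split; first exact: dilatation_comp ht.1 ht'.1.
have [[X /= eX]|h] := pselect (exists X, t (t' X) = X); last first.
  by right=> X e; apply: h; exists X.
left=> Y /=; have [[[[s tK sK] _] _] _] := ht.
rewrite -[RHS]sK; congr t.
apply: (@translation_uniq t' s X) => //; first exact: translation_inv ht tK sK.
by rewrite -{2}eX tK.
Qed.

Lemma translation_conj f t g : translation t -> iso f -> cancel f g ->
  cancel g f -> translation (f \o t \o g).
Proof.
move=> [dt ft] hf fK gK; split; first exact: dilatation_conj.
case: ft => h; [left=> X /=|right=> X /= e]; first by rewrite h gK.
by apply: (h (g X)); rewrite -{2}e fK.
Qed.

(** Both products send [A] to the fourth vertex of the parallelogram on [A], [t A], [t' A], which
    unique parallels determine. *)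
Lemma translation_comm_off t t' A : translation t -> translation t' ->
  t A <> A -> t' A <> A -> ~ lin A (t A) (t' A) -> t (t' A) = t' (t A).
Proof.
move=> ht ht' nA nA' nl.
have nmove s Y : translation s -> s A <> A -> s Y <> Y by move=> [_ [->|]].
have key s s' : translation s -> translation s' -> s A <> A -> s' A <> A ->
    let m := lin (s A) (s (s' A)) in
    [/\ is_lin m, m (s A), m (s (s' A)) & parallel m (lin A (s' A))] /\
    let m' := lin (s A) (s' (s A)) in
    [/\ is_lin m', m' (s A), m' (s' (s A)) & parallel m' (lin A (s' A))].
  move=> hs hs' ns ns'; split; split=> //; try exact: lin_l; try exact: lin_r.
  - by apply/is_lin_lin/(iso_neq hs.1.1)/nesym.
  - by apply: hs.1.2; exact: nesym.
  - by apply/is_lin_lin/nesym/nmove.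
  - by apply: parallel_sym; exact: translation_trace.
have [[l1 mA1 m1 p1] [l1' mA1' m1' p1']] := key t t' ht ht' nA nA'.
have [[l2 mA2 m2 p2] [l2' mA2' m2' p2']] := key t' t ht' ht nA' nA.
have e1 := parallel_uniq (is_lin_lin (nesym nA')) l1 l1' mA1 mA1' p1 p1'.
have e2 := parallel_uniq (is_lin_lin (nesym nA)) l2 l2' mA2 mA2' p2 p2'.
apply: contrapT => n.
rewrite -e1 in m1'; rewrite -e2 in m2'.
have e := is_lin_eq l1 l2 n m1 m1' m2' m2.
apply: nl; rewrite -(parallel_meet p2 (X := t A)) //; last exact: lin_r.
by rewrite -e.
Qed.

(** In the collinear case, a translation [s] off the line reduces to the previous lemma: [t]
    commutes with [s] and with [s \o t'], hence with [t']. *)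
Lemma translation_comm t t' A : translation t -> translation t' ->
  t (t' A) = t' (t A).
Proof.
move=> ht ht'.
have [tA|nA] := pselect (t A = A).
  by have [_ [h|/(_ A)//]] := ht; rewrite !h.
have [tA'|nA'] := pselect (t' A = A).
  by have [_ [h|/(_ A)//]] := ht'; rewrite !h.
have [l|nl] := pselect (lin A (t A) (t' A)); last first.
  exact: (translation_comm_off ht ht' nA nA' nl).
have hl := is_lin_lin (nesym nA); have [B nB] := is_lin_off hl.
have [s [_ hs sA]] := translation_ex A B.
have nsA : s A <> A by rewrite sA => e; apply: nB; rewrite e; exact: lin_l.
have nl' : ~ lin A (t A) (s A) by rewrite sA.
have ts := translation_comm_off ht hs nA nsA nl'.
have hst := translation_comp hs ht'.
have comm_s X : t (s X) = s (t X).
  have [hts hst'] := (translation_comp ht hs, translation_comp hs ht).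
  by apply: (@translation_uniq _ _ A X hts hst').
have nst : ~ lin A (t A) (s (t' A)).
  have el : lin A (t A) = lin A (t' A) by exact: lin_in (nesym nA) (nesym nA') (lin_l _ _) l.
  rewrite el => h; apply: nl'; rewrite el.
  rewrite -(parallel_meet (hs.1.2 _ _ (nesym nA')) (X := s (t' A))) //.
    exact: lin_l.
  exact: lin_r.
have nst' : s (t' A) <> A by move=> e; apply: nst; rewrite e; exact: lin_l.
have := translation_comm_off ht hst nA nst' nst.
by rewrite /= comm_s => /(iso_inj hs.1.1).
Qed.

(** * The group of translations *)

(* The plane becomes an abelian group with zero O, where A + B is the image of
   B under the translation taking O to A, and - is the half-turn about O. *)

Context (O : T).

Definition tau A : T -> T := sval (cid (translation_ex O A)).

Definition central : T -> T := sval (cid (half_turn_ex O)).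

Lemma tauP A : [/\ I (tau A), translation (tau A) & tau A O = A].
Proof. exact: svalP (cid (translation_ex O A)). Qed.

Lemma centralP : half_turn O central.
Proof. exact: svalP (cid (half_turn_ex O)). Qed.

Lemma tauE A t X : translation t -> t O = A -> tau A X = t X.
Proof.
move=> ht tO; have [_ hA AO] := tauP A.
by apply: (@translation_uniq _ _ O X hA ht); rewrite AO.
Qed.

(** This ties addition to half-turns: that [central] is negation and that vectors can be halved are
    both read off from it. *)
Lemma tau_half_turn A : exists M g,
  [/\ half_turn M g, g O = A & forall X, tau A X = g (central X)].
Proof.
have [M [g [hg ht gA]]] := translation_half_turn A centralP.
exists M, g; split=> // X; apply: (tauE X ht) => /=.
by have [_ -> _ _] := centralP.
Qed.

Lemma tauC A B : tau A B = tau B A.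
Proof.
have [[_ hA AO] [_ hB BO]] := (tauP A, tauP B).
by have := translation_comm O hA hB; rewrite AO BO.
Qed.

Lemma tauA A B C : tau A (tau B C) = tau (tau A B) C.
Proof.
have [[_ hA _] [_ hB BO]] := (tauP A, tauP B).
by apply/esym/(tauE C (translation_comp hA hB)); rewrite /= BO.
Qed.

Lemma tau0 A : tau O A = A.
Proof. exact: (tauE A translation_id). Qed.

Lemma tauN A : tau (central A) A = O.
Proof.
rewrite tauC; have [M [g [[_ _ gg _] gO ->]]] := tau_half_turn A.
by have [_ _ -> _] := centralP; rewrite -{1}gO gg.
Qed.

Definition point_choice : choiceType :=
  HB.pack T (gen_eqMixin T) (gen_choiceMixin T).

Definition vec : zmodType := HB.pack T (gen_eqMixin T) (gen_choiceMixin T)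
  (GRing.isZmodule.Build point_choice tauA tauC tau0 tauN).

Implicit Types e u v w x y z : vec.

Lemma bt_addr u v w z : bt (v + u) (w + u) (z + u) = bt v w z.
Proof.
have [It _ _] := tauP u; rewrite -(iso_bt v w z (I_iso It)).
by rewrite ![_ + u]addrC.
Qed.

Lemma I_addr u : I (fun v : vec => v + u).
Proof.
have [It _ _] := tauP u; rewrite (_ : (fun v => _) = tau u) //.
by apply/funext => v; rewrite addrC.
Qed.

Lemma bt_opp v : bt (0 : vec) v (- v).
Proof. by have [_ _ _ h] := centralP; exact: h. Qed.

Lemma vec_half v : exists2 w : vec, w + w = v & bt w (0 : vec) v.
Proof.
have [M [g [[_ gM gg bg] gO h]]] := tau_half_turn v.
exists M; last by rewrite -[v]gO; exact: bg.
have e : v - (M : vec) = M.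
  by rewrite -{2}gM -[X in g X](opprK (M : vec)); exact: (h (- (M : vec))).
by rewrite -{1}e subrK.
Qed.

(** Conjugating the translation by [v] with [f] gives a translation taking the origin to [f v],
    hence the translation by [f v]. *)
Lemma iso_add f v w : iso f -> f (0 : vec) = (0 : vec) ->
  f (v + w) = (f v : vec) + (f w : vec).
Proof.
move=> hf f0; have [[g fK gK] _] := hf; have [_ ht tO] := tauP v.
have gO : g O = O by rewrite -{1}(f0 : f O = O) fK.
have /= := tauE (f w) (translation_conj ht hf fK gK); rewrite fK => h.
by apply/esym/h; rewrite gO tO.
Qed.

Lemma lin_addr u v w z : lin (v + u) (w + u) (z + u) = lin v w z.
Proof. exact: (iso_lin v w z (I_iso (I_addr u))). Qed.

(** * Scalars *)

Context (R : realType).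

(** The origin lies between [- v] and [w]; translate by [v]. *)
Lemma bt_add_halfline e v w : 0 <> e -> halfline (0 : vec) e v ->
  halfline (0 : vec) e w -> bt v (0 : vec) (v + w).
Proof.
move=> e0 hv hw; have [->|/eqP v0] := eqVneq v 0; first exact: bt_l.
have hw' : halfline (0 : vec) v w by rewrite (halflineE e0 v0 hv).
have := halfline_opp (nesym v0) hw' (bt_opp v).
rewrite -(bt_addr v) add0r addNr => /bt_sym.
by rewrite addrC.
Qed.

Lemma bt_sub_halfline v w : bt v (0 : vec) w -> v <> 0 ->
  halfline (0 : vec) v (w - v).
Proof.
move=> h v0; apply: (opp_opp (Y := - v)).
- by move/(congr1 (fun z : vec => - z)); rewrite opprK oppr0.
- exact: bt_opp.
- by rewrite -(bt_addr v) add0r addNr subrK.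
Qed.

Lemma halflineD e v w : 0 <> e -> halfline (0 : vec) e v ->
  halfline (0 : vec) e w -> halfline (0 : vec) e (v + w).
Proof.
move=> e0 hv hw; have [->|/eqP v0] := eqVneq v 0; first by rewrite add0r.
by rewrite -(halflineE e0 v0 hv); right; exact: bt_add_halfline e0 hv hw.
Qed.

Lemma bt_halfline_sub e v w : 0 <> e -> halfline (0 : vec) e v ->
  halfline (0 : vec) e w -> bt v (0 : vec) w <-> halfline (0 : vec) e (w - v).
Proof.
move=> e0 hv hw; split=> h; last first.
  by have := bt_add_halfline e0 hv h; rewrite addrC subrK.
have [v0|/eqP v0] := eqVneq v 0; first by rewrite v0 subr0.
by rewrite -(halflineE e0 v0 hv); exact: bt_sub_halfline.
Qed.

Lemma halfline_opp0 e v : 0 <> e -> halfline (0 : vec) e v ->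
  halfline (0 : vec) e (- v) -> v = 0.
Proof.
move=> e0 hv hN; apply: contrapT => v0; apply: (halfline_end e0 v0 _ hv hN).
  by move/(congr1 (fun z : vec => - z)); rewrite opprK oppr0.
exact: bt_opp.
Qed.

(** [phi t] stands for the multiple of [e] by [t]. The clauses are the conclusion of
    [ordered_line_real] for the half-line of [e] as positive cone. *)
Definition scalar e (phi : R -> vec) :=
  [/\ forall s t, phi (s + t) = phi s + phi t, phi 1 = e,
      forall t, 0 < t -> halfline (0 : vec) e (phi t) /\ phi t <> 0
    & forall v, halfline (0 : vec) e v -> exists2 t, 0 <= t & phi t = v].

Lemma scalar_ex e : 0 <> e -> exists phi, scalar e phi.
Proof.
move=> e0; apply: ordered_line_real.
- by move=> v w; exact: halflineD.
- by move=> v; exact: halfline_opp0.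
- move=> v w hv hw; case: (halfline_total e0 hv hw) => /bt_halfline_sub h.
    by right; apply: h.
  by left; apply: h.
- move=> v hv; have [w ev hw] := vec_half v.
  exists w => //; have [v0|/eqP v0] := eqVneq v 0.
    by rewrite v0 in hw; rewrite (bt_id hw); exact: halfline_l.
  by rewrite -(halflineE e0 v0 hv); left.
- move=> S y [v0 Sv0] hS.
  have hy : halfline (0 : vec) e y.
    by have [h1 h2] := hS _ Sv0; rewrite -(subrK v0 y); exact: halflineD.
  have [y0|/eqP y0] := eqVneq y 0.
    have S0 v : S v -> v = 0.
      move=> Sv; apply/bt_id; rewrite -{2}y0; have [h1 h2] := hS _ Sv.
      exact/(bt_halfline_sub e0).
    exists 0; split; first exact: halfline_l.
    + by move=> x /S0 ->; rewrite subr0; exact: halfline_l.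
    + by move=> t ht _; rewrite subr0.
  have [||z [hz ub ls]] := @segment_lub (0 : vec) y S (nesym y0).
  + by move=> v /hS [h1 h2]; apply/(bt_halfline_sub e0).
  + by exists v0.
  have hz' : halfline (0 : vec) e z by rewrite -(halflineE e0 y0 hy); left.
  exists z; split=> //.
  + by move=> v Sv; apply/(bt_halfline_sub e0); [exact: (hS _ Sv).1| |exact: ub].
  + move=> t ht hSt; apply/(bt_halfline_sub e0) => //.
    case: (halfline_total e0 hy ht) => h; first exact: bt_sub h hz.
    apply: ls => // v Sv; apply/(bt_halfline_sub e0) => //; last exact: hSt.
    exact: (hS _ Sv).1.
- exact: halfline_r.
- exact: nesym.
Qed.

(** Such a [c] is monotone. Enclosing [n%:R * t] between consecutive integers shows that [n] times
    the deviation of [c t] from [t * c 1] never exceeds [c 1], so the deviation vanishes. *)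
Lemma additive_nonneg_linear (c : R -> R) :
  (forall s t, c (s + t) = c s + c t) -> (forall t, 0 < t -> 0 <= c t) ->
  forall t, c t = t * c 1.
Proof.
move=> cD c_ge0.
have c0 : c 0 = 0 by apply: (addrI (c 0)); rewrite -cD !addr0.
have cN t : c (- t) = - c t by apply: (addrI (c t)); rewrite -cD !subrr.
have mono s t : s <= t -> c s <= c t.
  rewrite le_eqVlt => /orP[/eqP -> //|]; rewrite -subr_gt0 => /c_ge0.
  by rewrite cD cN subr_ge0.
have cn (n : nat) t : c (n%:R * t) = n%:R * c t.
  elim: n => [|n IH]; first by rewrite !mul0r.
  by rewrite -natr1 !mulrDl !mul1r cD IH.
have cz (m : int) t : c (m%:~R * t) = m%:~R * c t.
  by case: m => n; rewrite ?NegzE ?mulrNz ?mulNr ?cN -pmulrn cn.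
have bound t (n : nat) : n%:R * `|c t - t * c 1| <= c 1.
  rewrite -[n%:R]ger0_norm // -normrM mulrBr -cn mulrA.
  have /andP[h1 h2] := floor_itv (n%:R * t); set m := Num.floor _ in h1 h2.
  have c1 : 0 <= c 1 by exact: c_ge0.
  have := mono _ _ h1; have := mono _ _ (ltW h2).
  rewrite -[(m + 1)%:~R]mulr1 -[m%:~R]mulr1 !cz => h3 h4.
  have h5 : m%:~R * c 1 <= n%:R * t * c 1 by exact: ler_wpM2r.
  have h6 : n%:R * t * c 1 <= (m + 1)%:~R * c 1 by exact/ler_wpM2r/ltW.
  rewrite intrD mulrDl mul1r in h3 h6.
  by rewrite ler_norml; apply/andP; split; lra.
move=> t; apply/eqP; rewrite -subr_eq0 -normr_eq0; apply/negPn/negP => n0.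
have d0 : 0 < `|c t - t * c 1| by rewrite lt_neqAle eq_sym n0 normr_ge0.
have c1 : 0 <= c 1 by exact: c_ge0.
have := bound t (Num.bound (c 1 / `|c t - t * c 1|)).
rewrite leNgt -ltr_pdivrMr // archi_boundP //.
by rewrite divr_ge0.
Qed.

(** The form fit for geometry: sides of a line and directions of rays reveal only signs of
    coordinates. *)
Lemma additive_sign_linear (c : R -> R) :
  (forall s t, c (s + t) = c s + c t) ->
  (forall t, 0 < t -> [/\ 0 < c 1 -> 0 < c t, c 1 < 0 -> c t < 0 & c 1 = 0 -> c t = 0]) ->
  forall t, c t = t * c 1.
Proof.
move=> cD h; case: (ltgtP (c 1) 0) => c1.
- move=> t; apply: oppr_inj; rewrite -mulrN.
  apply: (additive_nonneg_linear (c := fun t => - c t)) => [s u|u /h[_ h2 _]].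
    by rewrite cD opprD.
  by rewrite oppr_ge0 ltW // h2.
- by apply: additive_nonneg_linear => // u /h[h1 _ _]; rewrite ltW // h1.
- by apply: additive_nonneg_linear => // u /h[_ _ h3]; rewrite h3.
Qed.

(** * Coordinates *)

Section Scalar.

Context (e : vec) (phi : R -> vec) (e0 : 0 <> e) (hphi : scalar e phi).

Lemma scalarD s t : phi (s + t) = phi s + phi t.
Proof. by have [] := hphi. Qed.

Lemma scalar1 : phi 1 = e. Proof. by have [] := hphi. Qed.

Lemma scalar0 : phi 0 = 0.
Proof. by apply: (addrI (phi 0)); rewrite -scalarD !addr0. Qed.

Lemma scalarN t : phi (- t) = - phi t.
Proof. by apply: (addrI (phi t)); rewrite -scalarD !subrr scalar0. Qed.

Lemma scalar_pos t : 0 < t -> halfline (0 : vec) e (phi t) /\ phi t <> 0.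
Proof. by have [_ _ h _] := hphi; exact: h. Qed.

Lemma scalar_ge0 t : 0 <= t -> halfline (0 : vec) e (phi t).
Proof.
rewrite le_eqVlt => /orP[/eqP <-|/scalar_pos[]//].
by rewrite scalar0; exact: halfline_l.
Qed.

Lemma scalar_eq0 t : phi t = 0 -> t = 0.
Proof.
move=> h; case: (ltgtP t 0) => // t0; last by have [] := scalar_pos t0.
have /scalar_pos[_] : 0 < - t by rewrite oppr_gt0.
by rewrite scalarN h oppr0.
Qed.

Lemma scalar_inj : injective phi.
Proof.
move=> s t h; apply/subr0_eq/scalar_eq0.
by rewrite scalarD scalarN h subrr.
Qed.

Lemma scalar_lin v : lin (0 : vec) e v <-> exists t, v = phi t.
Proof.
have [_ _ _ sj] := hphi; split=> [/lin_halfline[/sj[t _ <-]|h]|[t ->]].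
- by exists t.
- have [v0|/eqP v0] := eqVneq v 0; first by exists 0; rewrite scalar0.
  have /sj[t _ e'] := opp_opp v0 h (bt_opp v).
  by exists (- t); rewrite scalarN e' opprK.
- case: (lerP 0 t) => t0; first exact/halfline_lin/scalar_ge0.
  have /scalar_pos[h _] : 0 < - t by rewrite oppr_gt0.
  rewrite -[t]opprK scalarN; set w := phi _ in h *; constructor 2.
  have [w0|/eqP w0] := eqVneq w 0; first by rewrite w0 oppr0; exact: bt_r.
  by apply: halfline_opp (halfline_sym h) (bt_opp w); exact: nesym.
Qed.

Lemma scalar_bt v : bt v (0 : vec) e <-> exists t, 0 <= t <= 1 /\ v = phi t.
Proof.
have [_ _ _ sj] := hphi; split=> [h|[t [/andP[t0 t1] ->]]].
  have hv : halfline (0 : vec) e v by left.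
  have [t t0 et] := sj _ hv.
  have /sj[s s0] := proj1 (bt_halfline_sub e0 hv (halfline_r (0 : vec) e)) h.
  rewrite -{1}scalar1 -et -scalarN -scalarD => /scalar_inj es.
  by exists t; split=> //; rewrite t0 -subr_ge0 -es.
apply/(bt_halfline_sub e0 (scalar_ge0 t0) (halfline_r (0 : vec) e)).
by rewrite -{2}scalar1 -scalarN -scalarD; apply: scalar_ge0; rewrite subr_ge0.
Qed.

End Scalar.

Section Coordinates.

Context (e1 e2 : vec) (phi1 phi2 : R -> vec).
Context (h1 : scalar e1 phi1) (h2 : scalar e2 phi2).
Context (ne1 : 0 <> e1) (ne2 : 0 <> e2) (n12 : ~ lin (0 : vec) e2 e1).

Let l2 := lin (0 : vec) e2.

Lemma coord_free (x y : R) : phi1 x + phi2 y = 0 -> x = 0 /\ y = 0.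
Proof.
move=> h; have x0 : x = 0.
  apply: (scalar_eq0 h1); apply: contrapT => nx.
  apply: n12; rewrite (_ : lin _ _ = lin (0 : vec) e1); first exact: lin_r.
  apply: (is_lin_eq (is_lin_lin ne2) (is_lin_lin ne1) (nesym nx)).
  - exact: lin_l.
  - by apply/(scalar_lin h2); exists (- y); rewrite (scalarN h2); apply/eqP; rewrite -addr_eq0 h.
  - exact: lin_l.
  - by apply/(scalar_lin h1); exists x.
split=> //; apply: (scalar_eq0 h2).
by move: h; rewrite x0 (scalar0 h1) add0r.
Qed.

(** Moving from [phi1 x] in the direction of [e2] cannot meet [l2]: a meeting point would put
    [phi1 x] itself on [l2]. *)
Lemma coord_pos (x y : R) : 0 < x -> side l2 e1 (phi1 x + phi2 y).
Proof.
move=> x0; have hl := is_lin_lin ne2; have [hx nx] := scalar_pos h1 x0.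
have s1 : side l2 e1 (phi1 x) by apply: (side_halfline hl (lin_l _ _)).
have [_ nlx _] := s1; apply: (side_trans hl s1).
have [->|/eqP y0] := eqVneq (phi2 y) 0; first by rewrite addr0; exact: side_refl.
have ny : phi1 x <> phi1 x + phi2 y.
  by move/(congr1 (fun z => - phi1 x + z)); rewrite addNr addKr => /esym.
have nlxy : ~ l2 (phi1 x + phi2 y).
  move/(scalar_lin h2) => [t /eqP]; rewrite -subr_eq0 -addrA -(scalarN h2) -(scalarD h2).
  by move/eqP/coord_free => [xe _]; rewrite xe ltxx in x0.
split=> // z hz lz; apply: nlx; rewrite /l2.
move: lz hz => /(scalar_lin h2)[t ->] hz.
have : lin (0 : vec) (phi2 y) (phi2 t - phi1 x).
  rewrite -(lin_addr (phi1 x)) add0r subrK [phi2 y + _]addrC.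
  by constructor 1.
have -> : lin (0 : vec) (phi2 y) = lin (0 : vec) e2.
  apply/esym/lin_in => //; [exact: nesym|exact: lin_l|].
  by apply/(scalar_lin h2); exists y.
move/(scalar_lin h2) => [s es]; apply/(scalar_lin h2); exists (t - s).
by rewrite (scalarD h2) (scalarN h2) -es opprB addrC subrK.
Qed.

Lemma coord_neg (x y : R) : x < 0 -> opposite l2 e1 (phi1 x + phi2 y).
Proof.
move=> x0; have hl := is_lin_lin ne2.
have /(coord_pos (- y)) s : 0 < - x by rewrite oppr_gt0.
rewrite (scalarN h1) (scalarN h2) -opprD in s; set v := _ + _ in s *.
have [_ nv _] := s.
have v0 : v <> 0 by move=> v0; apply: nv; rewrite v0 oppr0; exact: lin_l.
apply: (side_opposite hl s); apply: (opposite_bt hl (lin_l _ _)) => //.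
exact/bt_sym/bt_opp.
Qed.

Lemma coord_zero (x y : R) : l2 (phi1 x + phi2 y) <-> x = 0.
Proof.
split=> [h|->]; last by apply/(scalar_lin h2); exists y; rewrite (scalar0 h1) add0r.
case: (ltgtP x 0) => // x0.
- by case: (coord_neg y x0).
- by case: (coord_pos y x0).
Qed.

(** The parallel to [e2] through [v] meets the axis of [e1]; otherwise the two axes would be
    parallel, although both pass through the origin. *)
Lemma coord_onto v : exists x y : R, v = phi1 x + phi2 y.
Proof.
have [m [hm mv pm]] := parallel_ex v (is_lin_lin ne2).
have [x mx] : exists x : R, m (phi1 x).
  apply: contrapT => /forallNP h; apply: n12.
  have p1 : parallel (lin (0 : vec) e1) m.
    by right; apply/seteqP; split=> // z [/(scalar_lin h1)[x ->]] /h.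
  have p := parallel_trans (is_lin_lin ne1) hm (is_lin_lin ne2) p1 pm.
  by rewrite -(parallel_meet p (lin_l _ _) (lin_l _ _)); exact: lin_r.
have [->|/eqP n] := eqVneq v (phi1 x).
  by exists x, 0; rewrite (scalar0 h2) addr0.
have em : m = lin (phi1 x) v by apply: is_linE => //; exact: nesym.
have n0 : 0 <> v - phi1 x by move/esym/subr0_eq.
have [_ [[_ dt] _] _] := tauP (phi1 x).
have := dt _ _ n0; rewrite (_ : tau _ _ = phi1 x); last first.
  by have [_ _] := tauP (phi1 x).
rewrite (_ : tau _ _ = v); last first.
  by rewrite -[LHS]/(phi1 x + (v - phi1 x)) addrC subrK.
rewrite -em => p.
have p' := parallel_trans (is_lin_lin n0) hm (is_lin_lin ne2) (parallel_sym p) pm.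
have := lin_r (0 : vec) (v - phi1 x).
rewrite (parallel_meet p' (lin_l _ _) (lin_l _ _)) => /(scalar_lin h2)[y ey].
by exists x, y; rewrite -ey addrC subrK.
Qed.

(** Parallel projection is linear on every line through the origin: the points [phi t] with [t]
    positive form one open ray, so they lie together on one side of [l2] or on [l2], which fixes the
    sign of [c t]. *)
Lemma scalar_coord e phi (c d : R -> R) : 0 <> e -> scalar e phi ->
  (forall s t, c (s + t) = c s + c t) ->
  (forall t, phi t = phi1 (c t) + phi2 (d t)) -> forall t, c t = t * c 1.
Proof.
move=> e0 h cD phiE; apply: additive_sign_linear => // t t0.
have hl := is_lin_lin ne2; have [ht nt] := scalar_pos h t0.
have he := phiE 1; rewrite (scalar1 h) in he.
have off := @side_halfline l2 (0 : vec) e (phi t) hl (lin_l _ _).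
split=> hc.
- have s := coord_pos (d 1) hc; rewrite -he in s; have [_ ne _] := s.
  have st := side_trans hl s (off ne nt ht).
  case: (ltgtP (c t) 0) => // ct.
  + by have := coord_neg (d t) ct; rewrite -phiE => /(side_not_opposite st).
  + by have /coord_zero := ct => /(_ (d t)); rewrite -phiE; case: st.
- have s := coord_neg (d 1) hc; rewrite -he in s; have [_ ne _] := s.
  have st := opposite_sym (side_opposite hl (side_sym (off ne nt ht)) (opposite_sym s)).
  case: (ltgtP (c t) 0) => // ct.
  + by have := coord_pos (d t) ct; rewrite -phiE => /side_not_opposite.
  + by have /coord_zero := ct => /(_ (d t)); rewrite -phiE; case: st.
- have /coord_zero := hc => /(_ (d 1)); rewrite -he => le.
  apply/(coord_zero _ (d t)); rewrite -phiE /l2.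
  rewrite (lin_in ne2 e0 (lin_l _ _) le); exact: halfline_lin.
Qed.

End Coordinates.

Local Open Scope complex_scope.

Implicit Types p q r : R[i].

Definition coordinates (F : R[i] -> vec) :=
  [/\ forall p q, F (p + q) = F p + F q, bijective F
    & forall p q r, bt (F p) (F q) (F r) <-> complex_between p q r].

Lemma coordinates_ex e1 e2 : 0 <> e1 -> ~ lin (0 : vec) e1 e2 ->
  exists F, [/\ coordinates F, F 1 = e1 & F (0 +i* 1) = e2].
Proof.
move=> ne1 n21; have ne2 : 0 <> e2 by move=> e; apply: n21; rewrite -e; exact: lin_l.
have n12 : ~ lin (0 : vec) e2 e1.
  move=> h; apply: n21; rewrite -(lin_in ne2 ne1 (lin_l _ _) h); exact: lin_r.
have [phi1 h1] := scalar_ex ne1; have [phi2 h2] := scalar_ex ne2.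
pose F (z : R[i]) := phi1 (complex.Re z) + phi2 (complex.Im z).
have FD p q : F (p + q) = F p + F q.
  by case: p q => [a b] [c d]; rewrite /F /= (scalarD h1) (scalarD h2) addrACA.
have F0 : F 0 = 0 by apply: (addrI (F 0)); rewrite -FD !addr0.
have FN p : F (- p) = - F p by apply: (addrI (F p)); rewrite -FD !subrr.
have Finj p : F p = 0 -> p = 0.
  by case: p => a b /(coord_free h1 h2 ne1 ne2 n12) /= [-> ->].
have injF : injective F.
  by move=> p q e; apply/subr0_eq/Finj; rewrite FD FN e subrr.
have Fsurj v : exists p, F p = v.
  by have [x [y ->]] := coord_onto h1 h2 ne1 ne2 n12 v; exists (x +i* y).
(* Translations reduce betweenness to segments from the origin. There the parametrisation [phi] of
   the line through [F q] has both coordinates linear, by [scalar_coord] with the axes in either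
   role, so it agrees with real multiples of [q]. *)
have bt0 p q : bt (F p) (0 : vec) (F q) <-> exists t : R, 0 <= t <= 1 /\ p = t%:C * q.
  have [w0|/eqP w0] := eqVneq q 0.
    rewrite w0 F0; split=> [/bt_id e|[t [_ ->]]]; last by rewrite mulr0 F0; exact: bt_l.
    by exists 0; rewrite lexx ler01 mulr0; split=> //; exact: Finj.
  have e0 : 0 <> F q by move/esym/Finj.
  have [phi h] := scalar_ex e0.
  have /choice[c hc] : forall t : R, exists p, phi t = F p.
    by move=> t; have [p' <-] := Fsurj (phi t); exists p'.
  have cD s t : c (s + t) = c s + c t.
    by apply: injF; rewrite FD -!hc (scalarD h).
  have c1 : c 1 = q by apply: injF; rewrite -hc (scalar1 h).
  have re := scalar_coord h1 h2 ne1 ne2 n12 (c := fun t => complex.Re (c t))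
    (d := fun t => complex.Im (c t)) e0 h.
  have im := scalar_coord h2 h1 ne2 ne1 n21 (c := fun t => complex.Im (c t))
    (d := fun t => complex.Re (c t)) e0 h.
  have cE t : c t = t%:C * q.
    have := re _ hc t; have := im _ _ t; rewrite c1.
    case: (q) (c t) => [a b] [x y] /= hb ha.
    rewrite ha ?hb; first by congr Complex; ring.
    + by move=> s u; rewrite cD; case: (c s) (c u) => [? ?] [? ?].
    + by move=> s; rewrite hc /F addrC.
    + by move=> s u; rewrite cD; case: (c s) (c u) => [? ?] [? ?].
  rewrite (scalar_bt e0 h); split=> -[t [t01 e]]; exists t; split=> //.
    by apply: injF; rewrite e hc cE.
  by rewrite e -cE hc.
exists F; split; last 2 first.
- by rewrite /F /= (scalar1 h1) (scalar0 h2) addr0.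
- by rewrite /F /= (scalar0 h1) (scalar1 h2) add0r.
split=> //.
- have [G hG] := choice Fsurj; exists G => // z; exact: injF.
- move=> p q r; rewrite -(bt_addr (- F r)) subrr -!FN -!FD.
  have -> : bt (F (p - r)) (F (q - r)) (0 : vec) <-> bt (F (p - r)) (0 : vec) (F (q - r)).
    by split; exact: bt_sym.
  rewrite bt0; split=> -[t [t01 e]]; exists t; split=> //.
    apply/eqP; rewrite -(subrK r p) e rmorphB rmorph1; apply/eqP; ring.
  by rewrite e rmorphB rmorph1; ring.
Qed.

(** * Matrices of the motions fixing the origin *)

Section Matrices.

Context (F : R[i] -> vec) (hF : coordinates F).

Lemma coordD p q : F (p + q) = F p + F q.
Proof. by have [] := hF. Qed.

Lemma coord0 : F 0 = 0.
Proof. by apply: (addrI (F 0)); rewrite -coordD !addr0. Qed.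

Lemma coordN p : F (- p) = - F p.
Proof. by apply: (addrI (F p)); rewrite -coordD !subrr coord0. Qed.

Lemma coord_inj : injective F.
Proof. by have [_ /bij_inj] := hF. Qed.

Lemma coord_surj v : exists p, v = F p.
Proof. by have [_ [G _ GK] _] := hF; exists (G v); rewrite GK. Qed.

Lemma coord_bt p q r : bt (F p) (F q) (F r) <-> complex_between p q r.
Proof. by have [] := hF. Qed.

Lemma coord_halfline p q : q <> 0 ->
  halfline (0 : vec) (F q) (F p) <-> exists t : R, 0 <= t /\ p = t%:C * q.
Proof.
move=> q0; rewrite -coord0 /halfline /= !coord_bt; split.
  case=> -[t [/andP[t0 t1] e]]; rewrite mulr0 add0r in e.
    by exists (1 - t); rewrite subr_ge0.
  have n : 1 - t != 0 by apply/eqP => z; apply: q0; rewrite e z mul0r.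
  exists (1 - t)^-1; rewrite invr_ge0 subr_ge0 t1; split=> //.
  by rewrite e mulrA -rmorphM mulVf // mul1r.
case=> t [t0 ->]; case: (lerP t 1) => t1; [left|right].
  exists (1 - t); rewrite subr_ge0 t1 lerBlDr lerDl t0; split=> //.
  by rewrite mulr0 add0r opprB addrC subrK.
have n : t != 0 by rewrite gt_eqF // (lt_trans ltr01).
exists (1 - t^-1); rewrite subr_ge0 invf_le1 ?(lt_trans ltr01) // ltW //.
rewrite lerBlDr lerDl invr_ge0 t0; split=> //.
by rewrite mulr0 add0r opprB addrC subrK mulrA -rmorphM mulVf // mul1r.
Qed.

Lemma complex_between_parts p q r : complex_between p q r ->
  exists t : R, [/\ 0 <= t <= 1,
    complex.Re p = t * complex.Re q + (1 - t) * complex.Re r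
    & complex.Im p = t * complex.Im q + (1 - t) * complex.Im r].
Proof.
move=> [t [t01 ->]]; exists t; split=> //;
  by case: q r => [? ?] [? ?] /=; ring.
Qed.

Lemma coord_axis p : lin (0 : vec) (F 1) (F p) <-> complex.Im p = 0.
Proof.
rewrite -coord0; split=> [[]/coord_bt/complex_between_parts[t [_ /= e1 e2]]|p0].
- by rewrite e2; ring.
- have /eqP : (1 - t) * complex.Im p = 0 by rewrite e2; ring.
  rewrite mulf_eq0 => /orP[/eqP t1|/eqP //].
  have te : t = 1 by lra.
  by move: e1; rewrite te subrr mul0r mulr1 addr0 => /eqP; rewrite eq_sym oner_eq0.
- have /eqP : (1 - t) * complex.Im p = 0 by rewrite e2; ring.
  rewrite mulf_eq0 => /orP[/eqP t1|/eqP //].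
  by move: e1; rewrite t1 mul0r mulr0 addr0 => /eqP; rewrite oner_eq0.
- rewrite coord0; case: p p0 => a b /= ->.
  case: (lerP 0 a) => a0.
    have n1 : 1 <> 0 :> R[i] by apply/eqP; exact: oner_neq0.
    apply: halfline_lin; apply/(coord_halfline _ n1).
    by exists a; split=> //; rewrite mulr1.
  constructor 2; rewrite -coord0; apply/coord_bt; exists (- a / (1 - a)).
  have n : 1 - a != 0 by lra.
  split; last by apply/eqP; rewrite eq_complex /=; apply/andP; split; apply/eqP; field.
  by rewrite divr_ge0 /= ?ler_pdivrMr; lra.
Qed.

Lemma coord_side p q : 0 < complex.Im p -> 0 < complex.Im q ->
  side (lin (0 : vec) (F 1)) (F p) (F q).
Proof.
move=> p0 q0; split; try by move/coord_axis => e; rewrite e ltxx in p0 q0.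
move=> v; have [r ->] := coord_surj v.
move=> /coord_bt/complex_between_parts[t [/andP[t0 t1] _ e]] /coord_axis.
by rewrite e; nra.
Qed.

(* In the coordinates F, the columns of the matrix of f are (a, b) and (c, d). *)
Definition acts (f : T -> T) (a b c d : R) := forall x y : R,
  f (F (x +i* y)) = F ((a * x + c * y) +i* (b * x + d * y)).

Lemma acts_inj f a b c d a' b' c' d' :
  acts f a b c d -> acts f a' b' c' d' -> [/\ a = a', b = b', c = c' & d = d'].
Proof.
move=> h h'.
have := h 1 0; rewrite h' => /coord_inj; rewrite !mulr0 !mulr1 !addr0 => -[-> ->].
by have := h 0 1; rewrite h' => /coord_inj; rewrite !mulr0 !mulr1 !add0r => -[-> ->].
Qed.

Lemma acts_comp f g a b c d a' b' c' d' :
  acts f a b c d -> acts g a' b' c' d' ->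
  acts (f \o g) (a * a' + c * b') (b * a' + d * b')
    (a * c' + c * d') (b * c' + d * d').
Proof. by move=> h h' x y /=; rewrite h' h; congr F; congr Complex; ring. Qed.

Lemma acts_fix0 f a b c d : acts f a b c d -> f (0 : vec) = (0 : vec).
Proof. by move=> h; rewrite -coord0 h !mulr0 !addr0. Qed.

(** Additivity is known, so real homogeneity is what remains: [f] maps rays to rays, so [g] sends
    positive multiples of [p] to positive multiples of [g p], and [additive_sign_linear] applies to
    each coordinate. *)
Lemma acts_ex f : I f -> f (0 : vec) = (0 : vec) ->
  exists a b c d : R, acts f a b c d /\ a * d - b * c != 0.
Proof.
move=> If f0; have hf := I_iso If.
have /choice[g hg] : forall p, exists q, f (F p) = F q.
  by move=> p; exact: coord_surj.
have gD p q : g (p + q) = g p + g q.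
  by apply: coord_inj; rewrite coordD -!hg coordD iso_add.
have g0 p : g p = 0 -> p = 0.
  by move=> e; apply: coord_inj; apply: (iso_inj hf); rewrite hg e !coord0 f0.
have gZ (t : R) p : g (t%:C * p) = t%:C * g p.
  have [->|/eqP p0] := eqVneq p 0.
    by rewrite mulr0 (_ : g 0 = 0) ?mulr0 //; apply: coord_inj; rewrite -hg !coord0.
  have gp0 : g p <> 0 by move/g0.
  have pos (u : R) : 0 < u -> exists v : R, 0 < v /\ g (u%:C * p) = v%:C * g p.
    move=> u0; have : halfline (0 : vec) (F p) (F (u%:C * p)).
      by apply/coord_halfline => //; exists u; split=> //; exact: ltW.
    rewrite -(iso_halfline _ _ _ hf) f0 !hg => /(coord_halfline _ gp0)[v [v0 e]].
    exists v; split=> //; rewrite lt_neqAle v0 andbT; apply/eqP => z.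
    move: e; rewrite -z mul0r => /g0/eqP; rewrite mulf_eq0 => /orP[|/eqP//].
    by rewrite eq_complex /= eqxx andbT gt_eqF.
  have lin_part (k : R[i] -> R) : (forall q r, k (q + r) = k q + k r) ->
      (forall (s : R) q, k (s%:C * q) = s * k q) ->
      k (g (t%:C * p)) = t * k (g p).
    move=> kD kZ; rewrite (additive_sign_linear (c := fun u : R => k (g (u%:C * p)))).
    - by rewrite mul1r.
    - by move=> s u; rewrite rmorphD mulrDl gD kD.
    - move=> u /pos[v [v0 ->]]; rewrite mul1r kZ pmulr_rgt0 // pmulr_rlt0 //.
      by split=> // ->; rewrite mulr0.
  apply/eqP; rewrite eq_complex; apply/andP; split; apply/eqP.
  - rewrite lin_part; first by case: (g p) => a b /=; ring.
    + by move=> [? ?] [? ?].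
    + by move=> s [? ?] /=; ring.
  - rewrite lin_part; first by case: (g p) => a b /=; ring.
    + by move=> [? ?] [? ?].
    + by move=> s [? ?] /=; ring.
case e1 : (g 1) => [a b]; case e2 : (g (0 +i* 1)) => [c d].
have hfa : acts f a b c d.
  move=> x y; rewrite hg; congr F.
  have -> : x +i* y = x%:C * 1 + y%:C * (0 +i* 1).
    by apply/eqP; rewrite eq_complex /=; apply/andP; split; apply/eqP; ring.
  by rewrite gD !gZ e1 e2; apply/eqP; rewrite eq_complex /=; apply/andP; split; apply/eqP; ring.
exists a, b, c, d; split=> //; apply/eqP => det0.
have ker (x y : R) : a * x + c * y = 0 -> b * x + d * y = 0 -> x = 0 /\ y = 0.
  move=> ha hb; suff : x +i* y = 0 by move=> [-> ->].
  by apply: g0; apply: coord_inj; rewrite -hg hfa ha hb.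
(* With zero determinant, [(d, - b)] and [(c, - a)] lie in the kernel, so all entries vanish; then
   [(1, 1)] lies in the kernel too. *)
have [||d0 b0] := ker d (- b); [by rewrite -det0; ring|by ring|].
have [||c0 a0] := ker c (- a); [by ring|by rewrite -oppr0 -det0; ring|].
have [] := ker 1 1; first by rewrite c0 (_ : a = 0) ?mul0r ?addr0 //; lra.
  by rewrite d0 (_ : b = 0) ?mul0r ?addr0 //; lra.
by move=> /eqP; rewrite oner_eq0.
Qed.

Lemma coord_neq0 p : p <> 0 -> 0 <> F p.
Proof. by move=> p0 e; apply: p0; apply: coord_inj; rewrite coord0. Qed.

Lemma neq10 : 1 <> 0 :> R[i].
Proof. by apply/eqP; exact: oner_neq0. Qed.

Lemma acts_real f a b c d : acts f a b c d -> f (F 1) = F (a +i* b).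
Proof. by move=> /(_ 1 0) ->; rewrite !mulr0 !mulr1 !addr0. Qed.

Lemma acts_imag f a b c d : acts f a b c d -> f (F (0 +i* 1)) = F (c +i* d).
Proof. by move=> ->; rewrite !mulr0 !mulr1 !add0r. Qed.

Lemma acts_values f a b c d : I f -> f (0 : vec) = (0 : vec) ->
  f (F 1) = F (a +i* b) -> f (F (0 +i* 1)) = F (c +i* d) -> acts f a b c d.
Proof.
move=> If f0 e1 e2; have [a' [b' [c' [d' [h _]]]]] := acts_ex If f0.
move: e1 e2; rewrite (acts_real h) (acts_imag h).
by move=> /coord_inj[<- <-] /coord_inj[<- <-].
Qed.

(** Rigidity in matrix form: a triangular matrix with positive diagonal preserves the ray of [F 1]
    and the upper side of its line. *)
Lemma acts_flag f a c d : I f -> acts f a 0 c d -> 0 < a -> 0 < d ->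
  [/\ a = 1, c = 0 & d = 1].
Proof.
move=> If h a0 d0.
have fid v : f v = v.
  apply: (@motion_id f (0 : vec) (F 1) (F (0 +i* 1)) v If).
  - exact: coord_neq0 neq10.
  - exact: acts_fix0 h.
  - rewrite (acts_real h); apply/(coord_halfline _ neq10).
    by exists a; rewrite mulr1 ltW.
  - by rewrite (acts_imag h); apply: coord_side => /=.
have := acts_real h; have := acts_imag h; rewrite !fid => /coord_inj[<- <-].
by move=> /coord_inj/(congr1 (@complex.Re R)) /= <-.
Qed.

Context (sigma : T -> T) (Isigma : I sigma) (hsigma : acts sigma 1 0 0 (-1)).

Lemma acts_conj_l f a b c d : I f -> acts f a b c d ->
  I (sigma \o f) /\ acts (sigma \o f) a (- b) c (- d).
Proof.
move=> If h; split; first exact: I_comp.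
have := acts_comp hsigma h; congr acts; ring.
Qed.

Lemma acts_conj_r f a b c d : I f -> acts f a b c d ->
  I (f \o sigma) /\ acts (f \o sigma) a b (- c) (- d).
Proof.
move=> If h; split; first exact: I_comp.
have := acts_comp h hsigma; congr acts; ring.
Qed.

(** A motion with the prescribed first column up to a positive factor comes from the flag axiom;
    composing with [sigma] on the right corrects the sign of the determinant without touching that
    column. *)
Lemma acts_direction (s t : R) : s +i* t <> 0 ->
  exists f a b c d k, [/\ I f, acts f a b c d, 0 < a * d - b * c, 0 < k &
    a = k * s /\ b = k * t].
Proof.
move=> st0; have n0 := coord_neq0 st0.
have [Y nY] := is_lin_off (is_lin_lin n0).
have ni : ~ lin (0 : vec) (F 1) (F (0 +i* 1)).
  by move/coord_axis => /eqP /=; rewrite oner_eq0.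
have [f [If f0 hf1 _]] := motion_ex (coord_neq0 neq10) ni n0 nY.
have [a [b [c [d [h det]]]]] := acts_ex If f0.
have [k [k_pos ea eb]] : exists k, [/\ 0 < k, a = k * s & b = k * t].
  move: hf1; rewrite (acts_real h) => /(coord_halfline _ st0)[k [k0 e]].
  have [ea eb] : a = k * s /\ b = k * t.
    by move: e => /eqP; rewrite eq_complex /= => /andP[/eqP -> /eqP ->]; split; ring.
  exists k; split=> //; rewrite lt_neqAle k0 andbT; apply/eqP => z.
  by move/eqP: det; apply; rewrite ea eb -z; ring.
case: (ltgtP (a * d - b * c) 0) => hd.
- have [If' h'] := acts_conj_r If h.
  by exists (f \o sigma), a, b, (- c), (- d), k; split=> //; lra.
- by exists f, a, b, c, d, k.
- by rewrite hd eqxx in det.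
Qed.

(* A map of negative determinant has an eigenvector with positive eigenvalue k.
   Conjugated by a motion taking F 1 to the ray of that eigenvector, it fixes
   the flag of F 1 up to sigma, hence it is conjugate to sigma. *)
Lemma acts_reversing f a b c d : I f -> acts f a b c d -> a * d - b * c < 0 ->
  a + d = 0 /\ a * d - b * c = -1.
Proof.
move=> If h det.
(* [D] is the discriminant of the characteristic polynomial. A negative determinant makes it exceed
   the squared trace, so the larger root [k] is positive. *)
pose D := (a + d) ^+ 2 - 4 * (a * d - b * c).
have ltD : (a + d) ^+ 2 < D by rewrite /D; lra.
have D0 : 0 < D by exact: le_lt_trans (sqr_ge0 _) ltD.
pose k := ((a + d) + Num.sqrt D) / 2.
have kE : k ^+ 2 - (a + d) * k + (a * d - b * c) = 0.
  have : k * 2 - (a + d) = Num.sqrt D by rewrite /k; field.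
  by move/(congr1 (fun x : R => x ^+ 2)); rewrite sqr_sqrtr ?ltW // /D => e; lra.
have k0 : 0 < k.
  have ad : `|a + d| < Num.sqrt D by rewrite -sqrtr_sqr ltr_sqrt.
  by have := ler_norm (- (a + d)); rewrite normrN /k; lra.
(* Each row of the eigenvector equation suggests a solution, [(c, k - a)] or [(k - d, b)]. Both
   vanish only for the scalar matrix [k], whose determinant is not negative. *)
have [s [t [st0 es et]]] : exists s t : R,
    [/\ s +i* t <> 0, a * s + c * t = k * s & b * s + d * t = k * t].
  have [[c0 ka]|n] := pselect (c = 0 /\ k = a).
    have [[b0 kd]|n'] := pselect (b = 0 /\ k = d).
      by move: det; rewrite b0 c0 -ka -kd; nra.
    exists (k - d), b; split; last by ring.
    - by move=> [/subr0_eq kd b0]; apply: n'.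
    - by rewrite c0 ka; ring.
  exists c, (k - a); split; last by lra.
  - by move=> [c0 /subr0_eq ka]; apply: n.
  - by ring.
have [u [a1 [b1 [c1 [d1 [m [Iu hu detu m0 [ea eb]]]]]]]] := acts_direction st0.
have [u' [Iu' uK u'K]] := I_inv Iu.
pose g := u' \o f \o u.
have Ig : I g by apply: I_comp => //; exact: I_comp.
have f0 := acts_fix0 h; have u0 := acts_fix0 hu.
have g0 : g (0 : vec) = (0 : vec) by rewrite /g /= u0 f0 -{1}u0 uK.
have [a2 [b2 [c2 [d2 [hg _]]]]] := acts_ex Ig g0.
have e : u \o g = f \o u by apply/funext => v; rewrite /g /= u'K.
have := acts_comp hu hg; rewrite e => /(acts_inj (acts_comp h hu))[E1 E2 E3 E4].
have detg : a2 * d2 - b2 * c2 = a * d - b * c.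
  apply: (mulfI (x := a1 * d1 - b1 * c1)); first by rewrite gt_eqF.
  transitivity ((a1 * a2 + c1 * b2) * (b1 * c2 + d1 * d2) -
    (b1 * a2 + d1 * b2) * (a1 * c2 + c1 * d2)); first ring.
  by rewrite -E1 -E2 -E3 -E4; ring.
have e1 : a * a1 + c * b1 = k * a1 by rewrite ea eb -[k * _]mulrCA -es; ring.
have e2 : b * a1 + d * b1 = k * b1 by rewrite ea eb -[k * _]mulrCA -et; ring.
rewrite e1 in E1; rewrite e2 in E2.
have b20 : b2 = 0.
  apply: (mulfI (x := a1 * d1 - b1 * c1)); first by rewrite gt_eqF.
  transitivity (a1 * (b1 * a2 + d1 * b2) - b1 * (a1 * a2 + c1 * b2)); first ring.
  by rewrite -E1 -E2; ring.
have a2k : a2 = k.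
  apply: (mulfI (x := a1 * d1 - b1 * c1)); first by rewrite gt_eqF.
  transitivity (d1 * (a1 * a2 + c1 * b2) - c1 * (b1 * a2 + d1 * b2)); first ring.
  by rewrite -E1 -E2; ring.
rewrite b20 a2k in hg detg E1 E2 E3 E4.
have d20 : 0 < - d2 by nra.
have [Isg hsg] := acts_conj_l Ig hg; rewrite oppr0 in hsg.
have [k1 c20 d21] := acts_flag Isg hsg k0 d20.
have d2E : d2 = -1 by lra.
rewrite k1 d2E c20 in detg E1 E2 E3 E4 e1 e2.
split; last by rewrite -detg; ring.
(* Conjugation invariance of the trace, multiplied by the determinant of [u]: the columns of the
   matrix of [f \o u] are those of [u \o g], where [g] is now diagonal with entries [1] and [-1]. *)
apply: (mulfI (x := a1 * d1 - b1 * c1)); first by rewrite gt_eqF.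
transitivity (d1 * (a * a1 + c * b1) - b1 * (a * c1 + c * d1)
  + a1 * (b * c1 + d * d1) - c1 * (b * a1 + d * b1)); first ring.
by rewrite e1 e2 E3 E4; ring.
Qed.

(* Apply acts_reversing to sigma f and J sigma f, and compare traces. *)
Lemma acts_rotation J f a b c d : I J -> acts J 0 1 (-1) 0 ->
  I f -> acts f a b c d -> 0 < a * d - b * c ->
  [/\ c = - b, d = a & a ^+ 2 + b ^+ 2 = 1].
Proof.
move=> IJ hJ If h det.
have [Is hs] := acts_conj_l If h; have [] := acts_reversing Is hs; first lra.
have IJs := I_comp IJ Is; have hJs := acts_comp hJ hs.
have [] := acts_reversing IJs hJs; first lra.
by move=> t1 n1 t2 n2; split; nra.
Qed.

(** A motion with first column [k] times [(a, b)] exists; its first column has norm 1 by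
    [acts_rotation], and so has [(a, b)], which forces [k = 1]. *)
Lemma acts_unit J a b : I J -> acts J 0 1 (-1) 0 -> a ^+ 2 + b ^+ 2 = 1 ->
  exists f, I f /\ acts f a b (- b) a.
Proof.
move=> IJ hJ ab1.
have ab0 : a +i* b <> 0.
  by move=> [a0 b0]; move: ab1; rewrite a0 b0 expr0n addr0 => /eqP; rewrite eq_sym oner_eq0.
have [f [a' [b' [c [d [k [If h det k0 [ea eb]]]]]]]] := acts_direction ab0.
have [ec ed n] := acts_rotation IJ hJ If h det.
have k1 : k = 1.
  have : k ^+ 2 = 1 by rewrite -n ea eb -[LHS]mulr1 -ab1; ring.
  by move/eqP; rewrite sqrf_eq1 => /orP[/eqP //|/eqP kN]; move: k0; rewrite kN; lra.
rewrite ec ed ea eb k1 !mul1r in h.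
by exists f.
Qed.

End Matrices.

(** * Adapted frame and identification of the group *)

(** The motion that keeps a ray and exchanges the sides of its line is an involution; for [X] off
    the line, [X - s X] is reversed by it and serves as [e2]. *)
Lemma reflection_ex : exists e1 e2 sigma, [/\ I sigma, 0 <> e1,
  ~ lin (0 : vec) e1 e2, sigma (0 : vec) = (0 : vec) &
  sigma e1 = e1 /\ sigma e2 = - e2].
Proof.
have [e1 ne1] : exists e1, 0 <> e1.
  have [_ [B [C nBC]] _] := plane_bt.
  by have [e|n] := pselect (O = B); [exists C => e'; apply: nBC; rewrite -e|exists B].
have hl := is_lin_lin ne1; have [X nX] := is_lin_off hl.
have [X' oX] := opposite_ex hl nX; have nX' : ~ lin (0 : vec) e1 X' by case: oX.
have [s [Is s0 hs sX]] := motion_ex ne1 nX ne1 nX'.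
have hsi := I_iso Is.
have nse : s e1 <> (0 : vec) by rewrite -{1}s0 => /(iso_inj hsi)/esym.
have eh := halflineE ne1 nse hs.
have el : lin (0 : vec) (s e1) = lin (0 : vec) e1.
  by rewrite -(lin_in ne1 (nesym nse) (lin_l _ _)) //; exact: halfline_lin.
have oXs : opposite (lin (0 : vec) e1) X (s X).
  by apply/opposite_sym/(side_opposite hl (side_sym sX))/opposite_sym.
have ss Y : s (s Y) = Y.
  apply: (@motion_id (s \o s) (0 : vec) e1 X Y (I_comp Is Is)) => //=.
  - by rewrite !s0.
  - by rewrite -eh -{1}s0 iso_halfline.
  - apply: (opposite_opposite hl oXs).
    by rewrite -{1}el -{1}s0 iso_opposite.
(* [s] preserves the order along the ray and is an involution: if one of [e1], [s e1] precedes the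
   other, applying [s] gives the reverse. *)
have se1 : s e1 = e1.
  case: (halfline_total ne1 hs (halfline_r _ _)) => h.
  - by apply: (bt_anti h); rewrite -{1}(ss e1) -{1}s0 iso_bt.
  - by apply/esym/(bt_anti h); rewrite -{2}(ss e1) -{1}s0 iso_bt.
have sN v : s (- v) = - (s v : vec).
  by apply: (addrI (s v : vec)); rewrite -iso_add // !subrr.
pose N : vec := (X : vec) - (s X : vec).
have sNN : s N = - N.
  by rewrite /N iso_add // sN ss opprB addrC.
have half v : halfline (0 : vec) e1 v -> halfline (0 : vec) e1 (s v).
  by move=> hv; rewrite -{1}se1 -{1}s0 iso_halfline.
exists e1, N, s; split=> //.
(* On the line, [s] keeps half-lines while it negates [N], so [N] would be zero; but then [X = s X],
   although [s] moves [X] to the other side. *)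
move=> lN; have N0 : N = 0.
  apply: contrapT => N0; apply: N0; case: (lin_halfline lN) => h.
    by apply: (halfline_opp0 ne1 h); rewrite -sNN; exact: half.
  have [//|/eqP N0] := eqVneq N 0.
  have h' := opp_opp N0 h (bt_opp N).
  apply: oppr_inj; rewrite oppr0; apply: (halfline_opp0 ne1 h').
  by rewrite -sNN -sN; exact: half.
have XsX : X = s X := @subr0_eq vec X (s X) N0.
by move: oXs; rewrite -XsX => /side_not_opposite; apply; exact: side_refl.
Qed.

(** In a first frame, let [J] send [F 1] to [k] times the second basis vector. Since [J \o sigma] is
    orientation-reversing, trace 0 and determinant -1 give [d = 0] and [c * b = -1]. Replacing the
    second basis vector by its multiple by [k], the image of the first under [J], turns [J] into the
    standard quarter-turn and keeps [sigma] diagonal. *)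
Lemma frame_ex : exists F sigma J, [/\ coordinates F, I sigma,
  acts F sigma 1 0 0 (-1), I J & acts F J 0 1 (-1) 0].
Proof.
have [e1 [N [s [Is ne1 nN s0 [se1 sN]]]]] := reflection_ex.
have sopp v : s (- v) = - (s v : vec).
  by apply: (addrI (s v : vec)); rewrite -iso_add ?subrr //; exact: I_iso.
have [F [hF F1 Fi]] := coordinates_ex ne1 nN.
have hs : acts F s 1 0 0 (-1).
  apply: (acts_values hF) => //; first by rewrite F1 se1 -F1.
  rewrite Fi sN -Fi -(coordN hF); congr F; congr Complex; exact: oppr0.
have n01 : 0 +i* 1 <> 0 :> R[i] by case=> /eqP; rewrite oner_eq0.
have [J [a [b [c [d [k [IJ hJ det k0 [ea eb]]]]]]]] := acts_direction hF Is hs n01.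
have [IJs hJs] := acts_conj_r Is hs IJ hJ.
have [|tr dt] := acts_reversing hF Is hs IJs hJs; first lra.
rewrite mulr0 in ea; rewrite mulr1 in eb.
have d0 : d = 0 by lra.
have bc : c * b = -1 by move: dt; rewrite ea; lra.
rewrite ea eb d0 in hJ bc.
have nb : ~ lin (0 : vec) e1 (F (0 +i* k)).
  by rewrite -F1 => /(coord_axis hF) /= kz; rewrite kz ltxx in k0.
have [F' [hF' F'1 F'i]] := coordinates_ex ne1 nb.
exists F', s, J; split=> //.
- apply: (acts_values hF') => //; first by rewrite F'1 se1 -F'1.
  rewrite F'i hs !mulr0 !mul0r !addr0 add0r mulN1r.
  rewrite -[RHS]opprK -(coordN hF').
  have -> : - (0 +i* -1) = 0 +i* 1 :> R[i] by congr Complex; rewrite ?oppr0 ?opprK.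
  by rewrite F'i -(coordN hF); congr F; congr Complex; rewrite oppr0.
- apply: (acts_values hF') => //; first exact: (acts_fix0 hF hJ).
    by rewrite F'1 -F1 (acts_real hJ) -F'i.
  rewrite F'i hJ !(mulr0, mul0r, add0r) bc.
  have e (K : R[i] -> vec) : coordinates K -> K (-1 +i* 0) = - K 1.
    by move=> hK; rewrite -(coordN hK); congr K; congr Complex; rewrite oppr0.
  by rewrite (e _ hF) (e _ hF') F1 F'1.
Qed.

Lemma erlangen_isomorphic_complex :
  erlangen_isomorphic bt I (@complex_between R) (@complex_group R).
Proof.
have [F [s [J [hF Is hs IJ hJ]]]] := frame_ex.
have [_ [G FG GF] _] := hF.
have iG : isomorphism bt (@complex_between R) G.
  split; first by exists F.
  move=> A B; apply/seteqP; split=> [_ [C hC <-]|p hp].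
    by apply/(coord_bt hF); rewrite !GF.
  by exists (F p); rewrite ?FG //; rewrite /segment /= -(GF A) -(GF B); apply/(coord_bt hF).
exists G, F; split=> // g bg.
(* Translations belong to [I], so membership only depends on the part fixing the origin. *)
have shift (f h : vec -> vec) (w : R[i]) :
    I h -> (forall p, f (F p) = h (F p) + F w) -> I f.
  move=> Ih e; rewrite (_ : f = (fun v : vec => v + F w) \o h).
    by apply: I_comp => //; exact: I_addr.
  by apply/funext => v; rewrite -(GF v) e.
split.
- move=> [a [b [w [ab1 hg]]]]; have [f [If hf]] := acts_unit hF Is hs IJ hJ ab1.
  case: hg => hg.
  + apply: (shift _ f w If) => -[x y] /=.
    rewrite FG hg hf -(coordD hF); congr F; congr (_ + _).
    by congr Complex; ring.
  + have [Ifs hfs] := acts_conj_r Is hs If hf.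
    apply: (shift _ _ w Ifs) => -[x y].
    rewrite [LHS]/= FG hg hfs -(coordD hF); congr F; congr (_ + _).
    by congr Complex; ring.
- move=> Ih; pose w := g 0.
  (* Conversely, removing the translation part [w = g 0] leaves a motion fixing the origin, hence a
     matrix. *)
  pose f : T -> T := (fun v : vec => v + F (- w)) \o (F \o g \o G).
  have If : I f by apply: I_comp => //; exact: I_addr.
  have fF p : f (F p) = F (g p - w) by rewrite /f /= FG (coordD hF).
  have f0 : f (0 : vec) = (0 : vec) by rewrite -(coord0 hF) fF subrr.
  have [a [b [c [d [hf det]]]]] := acts_ex hF If f0.
  have gE (x y : R) : g (x +i* y) = ((a * x + c * y) +i* (b * x + d * y)) + w.
    by apply/eqP; rewrite -subr_eq; apply/eqP/(coord_inj hF); rewrite -fF hf.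
  (* A negative determinant is the conjugate-linear case: [sigma] is complex conjugation in this
     frame, and [f \o sigma] is a rotation. *)
  case: (ltgtP (a * d - b * c) 0) => hd; last by rewrite hd eqxx in det.
  + have [Ifs hfs] := acts_conj_r Is hs If hf.
    have [|ec ed n] := acts_rotation hF Is hs IJ hJ Ifs hfs; first lra.
    exists a, b, w; split=> //; right=> -[x y]; rewrite gE; congr (_ + _).
    have -> : c = b by lra.
    have -> : d = - a by lra.
    by congr Complex; ring.
  + have [ec ed n] := acts_rotation hF Is hs IJ hJ If hf hd.
    exists a, b, w; split=> //; left=> -[x y]; rewrite gE ec ed; congr (_ + _).
    by congr Complex; ring.
Qed.

End EuclideanPlane.

Theorem theorem19p7 (R : realType) (T : Type) (bt : T -> T -> T -> Prop)
    (I : set (T -> T)) :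
  euclidean_plane bt I ->
  erlangen_isomorphic bt I (@complex_between R) (@complex_group R).
Proof.
move=> h; have [[[_ [O _] _] _ _] _] := h.
exact: (erlangen_isomorphic_complex h O R).
Qed.
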